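(* Let $\sigma>0$ and let $\Upsilon$ be an open set with compact closure contained in $\Omega_\sigma$. There exist $N_0\in\mathbb N$ and $C>0$, depending only on $\sigma$ and $\Upsilon$, such that the following holds for all integers $N\ge N_0$, all $\lambda\in\mathbb R$, all $\kappa\ge0$ and all $s\in\Upsilon$: if $u,f\in C^\infty(\overline I)$ satisfy $\frac{d}{dx}\big((\kappa x+x^2)\frac{du}{dx}\big)+s\frac{du}{dx}-N(N+1)u+\lambda\sum_{i=0}^{N-1}\frac{(x-1)^i}{i!}u^{(i+1)}(1)=f$, $u(1)=0$, with $|f|^N_{\sigma,0,0}+|f|^N_{\sigma,1,0}+[f]^N_\sigma<\infty$ and $|\partial_xu|^N_{\sigma,0,0}+|\partial_xu|^N_{\sigma,1,0}+|\partial_xu|^N_{\sigma,2,0}+[\partial_xu]^N_\sigma<\infty$, then $|\partial_xu|^N_{\sigma,0,0}+|\partial_xu|^N_{\sigma,1,0}+|\partial_xu|^N_{\sigma,2,0}+[\partial_xu]^N_\sigma\le C\big(|f|^N_{\sigma,0,0}+|f|^N_{\sigma,1,0}+[f]^N_\sigma\big)$.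
   Context: $I=(0,1)$. For $\sigma>0$, $u\in C^\infty(\overline I)$, integer $N\ge0$, $k\in\{0,1,2\}$: $|u|^{N}_{\sigma,k,0}=\big(\sum_{n=N}^\infty\frac{\sigma^{2n}}{n!^2(n+1)!^2}n^{k}\int_0^1(x/\sigma)^k|\partial_x^nu|^2dx\big)^{1/2}$ (with $0^0:=1$), and $[u]^N_\sigma=\big(\sum_{n=N}^\infty\frac{\sigma^{2n+1}}{n!^2(n+1)!^2}|u^{(n)}(0)|^2\big)^{1/2}$. For $\sigma>0$: $\Omega^1_\sigma=\{s:\Re s\le0,\ \sigma<|\Im s|\}\cup\{s:\Re s>0,\ \sigma<|s|\}$; $\Omega^2_\sigma=\{s:\ \sigma<|s|+\Re s,\ \sigma>\frac{-\Re(s)|s|}{2(|s|+\Re s)}\}$; $\Omega^3_\sigma=\{s\neq0:\ \sigma(|s|-\sigma+\Re s)-(\sigma(1+\frac{\Re s}{|s|})+\frac12\Re s)^2>0\}$; $\Omega_\sigma=\Omega^1_\sigma\cap(\Omega^2_\sigma\cup\Omega^3_\sigma)$. *)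

(* Defs.v *)
(* classical real analysis. Complex numbers are represented
   by pairs (real part, imaginary part) of reals. *)
From Stdlib Require Import Reals Lra ClassicalEpsilon Arith Factorial.
Open Scope R_scope.

Definition inI (x : R) : Prop := 0 <= x <= 1.

Definition deriv_within (g : R -> R) (x l : R) : Prop :=
  limit1_in (fun y => (g y - g x) / (y - x)) (fun y => inI y /\ y <> x) l x.

(* D is the sequence of derivatives of the C^infty(Ibar) function D 0:
   D (S n) is the derivative (within Ibar) of D n at every point of Ibar. *)
Definition smooth_seq (D : nat -> R -> R) : Prop :=
  forall n x, inI x -> deriv_within (D n) x (D (S n) x).

(* Riemann integral over [0,1] (the value is proof-independent) *)
Definition integral01 (g : R -> R) : R :=
  epsilon (inhabits 0)
    (fun l => exists pr : Riemann_integrable g 0 1, RiemannInt pr = l).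

Definition series_from (a : nat -> R) (N : nat) : nat -> R :=
  fun m => sum_f_R0 (fun j => a (N + j)%nat) m.
Definition series_finite (a : nat -> R) (N : nat) : Prop :=
  exists l, Un_cv (series_from a N) l.
Definition series_value (a : nat -> R) (N : nat) : R :=
  epsilon (inhabits 0) (fun l => Un_cv (series_from a N) l).

Definition wt (sigma : R) (n : nat) : R :=
  sigma ^ (2 * n) / ((INR (fact n)) ^ 2 * (INR (fact (S n))) ^ 2).

(* terms of |u|^N_{sigma,k,0}^2, u = Dr 0 + i Di 0 (0^0 = 1 via pow) *)
Definition term_k (sigma : R) (k : nat) (Dr Di : nat -> R -> R) (n : nat) : R :=
  wt sigma n * (INR n) ^ k *
  integral01 (fun x => (x / sigma) ^ k * ((Dr n x) ^ 2 + (Di n x) ^ 2)).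

Definition term_b (sigma : R) (Dr Di : nat -> R -> R) (n : nat) : R :=
  wt sigma n * sigma * ((Dr n 0) ^ 2 + (Di n 0) ^ 2).

Definition normk (sigma : R) (k N : nat) (Dr Di : nat -> R -> R) : R :=
  sqrt (series_value (term_k sigma k Dr Di) N).
Definition normb (sigma : R) (N : nat) (Dr Di : nat -> R -> R) : R :=
  sqrt (series_value (term_b sigma Dr Di) N).
Definition normk_finite (sigma : R) (k N : nat) (Dr Di : nat -> R -> R) : Prop :=
  series_finite (term_k sigma k Dr Di) N.
Definition normb_finite (sigma : R) (N : nat) (Dr Di : nat -> R -> R) : Prop :=
  series_finite (term_b sigma Dr Di) N.

(* shift: derivative sequence of d/dx u *)
Definition dshift (D : nat -> R -> R) : nat -> R -> R := fun n => D (S n).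

Fixpoint sumR (n : nat) (g : nat -> R) : R :=
  match n with O => 0 | S m => sumR m g + g m end.

Definition cabs (a b : R) : R := sqrt (a ^ 2 + b ^ 2).

Definition Omega1 (sigma a b : R) : Prop :=
  (a <= 0 /\ sigma < Rabs b) \/ (0 < a /\ sigma < cabs a b).
Definition Omega2 (sigma a b : R) : Prop :=
  sigma < cabs a b + a /\ sigma > - a * cabs a b / (2 * (cabs a b + a)).
Definition Omega3 (sigma a b : R) : Prop :=
  (a, b) <> (0, 0) /\
  sigma * (cabs a b - sigma + a)
    - (sigma * (1 + a / cabs a b) + a / 2) ^ 2 > 0.
Definition Omega (sigma a b : R) : Prop :=
  Omega1 sigma a b /\ (Omega2 sigma a b \/ Omega3 sigma a b).

Definition dist2 (a b a' b' : R) : R := cabs (a - a') (b - b').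
Definition open2 (U : R -> R -> Prop) : Prop :=
  forall a b, U a b -> exists eps, 0 < eps /\
    forall a' b', dist2 a b a' b' < eps -> U a' b'.
Definition closure2 (U : R -> R -> Prop) (a b : R) : Prop :=
  forall eps, 0 < eps -> exists a' b', U a' b' /\ dist2 a b a' b' < eps.
Definition bounded2 (U : R -> R -> Prop) : Prop :=
  exists M, forall a b, U a b -> cabs a b <= M.
(* closure is compact (= closed and bounded in R^2) and contained in Omega *)
Definition compact_closure_in (U : R -> R -> Prop) (V : R -> R -> Prop) : Prop :=
  bounded2 (closure2 U) /\ (forall a b, closure2 U a b -> V a b).

(* Main.v *)
Require Import Defs.
From Stdlib Require Import Reals Arith Factorial Lra Lia ClassicalEpsilon Classical.
From Coquelicot Require Import Coquelicot.
Open Scope R_scope.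

(** Put V_n = sigma^n / (n! (n+1)!) u^(n+1) and F_n = sigma^n / (n! (n+1)!) f^(n).
    Differentiating the equation n >= N times kills the lambda term and gives
      (n+1)(n+2)/sigma w V_{n+1} + T_n V_n + s V_n + c_n sigma V_{n-1} = F_n,
    with w = kappa x + x^2, T_n = (n+1)(kappa + 2x), c_n = 1 - N(N+1)/(n(n+1)); since
    c_N = 0 the system is closed for n >= N.  Moreover V_{n+1} is a multiple of V_n', so
    Re (V_{n+1} conj V_n) is a derivative, with the good sign at x = 1.

    At x = 0 the equation reads (s + (n+1) kappa) V_n + c_n sigma V_{n-1} = F_n, and
    |s + (n+1) kappa| > sigma controls the boundary values.  In the interior, the
    real part of the equation times conj V_n yields T_n + Re s, which suffices for
    Re s > 0.  For Re s <= 0 one adds cutoff(T_n) times the imaginary part, which localises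
    to T_n < 2 sqrt(sigma |Im s|): there the cross terms Im (V_{n+1} conj V_n), whose total
    coefficient is at most max(T_n^2/(4 sigma), sigma) up to O(1/n), are dominated by
    |Im s|, because Omega_sigma forces |Im s| > sigma and 4 sigma |Im s| > (Re s)^2 when
    Re s <= 0.  The multiplier (n+1) x conj V_n gives the weighted norms. *)

(** The couplings of V_n to its neighbours are as large as the diagonal terms, so no index can be
    estimated alone: they must cancel or telescope in n. The real couplings are derivatives on both
    sides: V_{n+1} is a multiple of V_n' and V_n one of V_{n-1}'. The second produces
    |V_{n-1}(0)|^2, so the boundary values have to be controlled first.

    The quantity Im (V_{n+1} conj V_n) enters the equations n and n+1 with opposite signs. Its total
    coefficient is a difference of nonnegative numbers, hence bounded by their maximum instead of
    their sum; T^2/(4 sigma) comes from w <= (w')^2/4. For Re s <= 0 the real part is useful for T >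
    -Re s and the imaginary part for T < 2 sqrt(sigma |Im s|), so (Re s)^2 < 4 sigma |Im s| says
    that the two ranges overlap, which leaves room for a Lipschitz cutoff. As T_{n+1} - T_n =
    T_n/(n+1), shifting its index costs O(1/n); this error, like the w'/2 lost by integrating by
    parts, is the reason for N_0.

    Telescoping a partial sum leaves a term at the last index. It is bounded by two consecutive
    energies and tends to 0 because the norms of u' are finite. *)

(** * Calculus on the closed unit interval *)

Lemma deriv_within_D_in (g : R -> R) (x l : R) :
  deriv_within g x l <-> D_in g (fun _ => l) inI x.
Proof.
  unfold deriv_within, D_in, limit1_in, limit_in, D_x; simpl.
  split; intros H eps Heps; destruct (H eps Heps) as [d [Hd H']];
    exists d; (split; [exact Hd|]); intros y [[Hy Hyx] Hlt];
    apply H'; repeat split; try apply Hy; auto.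
Qed.

Lemma deriv_within_eq (f g : R -> R) (x l l' : R) :
  (forall y, inI y -> f y = g y) -> inI x -> l = l' ->
  deriv_within f x l -> deriv_within g x l'.
Proof.
  intros Hfg Hx -> H eps Heps. destruct (H eps Heps) as [d [Hd H']].
  exists d; split; [exact Hd|]. intros y [Hy Hlt].
  rewrite <- (Hfg y), <- (Hfg x) by tauto. apply H'; tauto.
Qed.

Lemma deriv_within_const (c x : R) : deriv_within (fun _ => c) x 0.
Proof. apply deriv_within_D_in. apply (Dconst inI c x). Qed.

Lemma deriv_within_id (x : R) : deriv_within (fun y => y) x 1.
Proof. apply deriv_within_D_in. apply (Dx inI x). Qed.

Lemma deriv_within_plus (f g : R -> R) (x l m : R) :
  deriv_within f x l -> deriv_within g x m ->
  deriv_within (fun y => f y + g y) x (l + m).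
Proof.
  rewrite !deriv_within_D_in. intros Hf Hg.
  apply (Dadd inI (fun _ => l) (fun _ => m) f g x Hf Hg).
Qed.

Lemma deriv_within_mult (f g : R -> R) (x l m : R) :
  deriv_within f x l -> deriv_within g x m ->
  deriv_within (fun y => f y * g y) x (l * g x + f x * m).
Proof.
  rewrite !deriv_within_D_in. intros Hf Hg.
  apply (Dmult inI (fun _ => l) (fun _ => m) f g x Hf Hg).
Qed.

Lemma deriv_within_scal (c : R) (f : R -> R) (x l : R) :
  deriv_within f x l -> deriv_within (fun y => c * f y) x (c * l).
Proof.
  rewrite !deriv_within_D_in. intros Hf.
  apply (Dmult_const inI f (fun _ => l) x c Hf).
Qed.

Lemma deriv_within_unique (g : R -> R) (x l l' : R) :
  inI x -> deriv_within g x l -> deriv_within g x l' -> l = l'.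
Proof.
  intros Hx H H'. refine (single_limit _ _ _ _ x _ H H').
  intros alp Halp. unfold inI in *.
  (* Approach [x] from the side on which the interval has length at least 1/2. *)
  destruct (Rle_or_lt x (1/2)) as [Hh|Hh].
  - exists (x + Rmin (alp/2) (1/2)).
    assert (0 < Rmin (alp/2) (1/2)) by (apply Rmin_glb_lt; lra).
    pose proof (Rmin_l (alp/2) (1/2)). pose proof (Rmin_r (alp/2) (1/2)).
    simpl; unfold Rdist. rewrite Rabs_right by lra. lra.
  - exists (x - Rmin (alp/2) (1/2)).
    assert (0 < Rmin (alp/2) (1/2)) by (apply Rmin_glb_lt; lra).
    pose proof (Rmin_l (alp/2) (1/2)). pose proof (Rmin_r (alp/2) (1/2)).
    simpl; unfold Rdist. rewrite Rabs_left by lra. lra.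
Qed.

(* Functions that are smooth on [0,1] are unconstrained outside; composing with [clamp]
   turns them into continuous functions on the line. *)
Definition clamp (x : R) : R := Rmax 0 (Rmin 1 x).

Lemma clamp_inI (x : R) : inI (clamp x).
Proof. unfold clamp, inI, Rmax, Rmin; repeat destruct Rle_dec; lra. Qed.

Lemma clamp_id (x : R) : inI x -> clamp x = x.
Proof. unfold clamp, inI, Rmax, Rmin; repeat destruct Rle_dec; lra. Qed.

Lemma clamp_lipschitz (x y : R) : Rabs (clamp y - clamp x) <= Rabs (y - x).
Proof.
  unfold clamp, Rmax, Rmin; repeat destruct Rle_dec; unfold Rabs;
    repeat destruct Rcase_abs; lra.
Qed.

Definition contI (g : R -> R) : Prop :=
  forall x, continuous (fun y => g (clamp y)) x.

Lemma contI_continuous (g : R -> R) : (forall x, continuous g x) -> contI g.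
Proof.
  intros H x. apply continuous_comp; [|apply H].
  apply filterlim_locally. intros eps. exists eps. intros y Hy.
  apply Rle_lt_trans with (2 := Hy). apply clamp_lipschitz.
Qed.

Lemma contI_deriv (g dg : R -> R) :
  (forall x, inI x -> deriv_within g x (dg x)) -> contI g.
Proof.
  intros H x.
  assert (Hc : continue_in g inI (clamp x)).
  { apply (cont_deriv g (fun _ => dg (clamp x))).
    apply deriv_within_D_in, H, clamp_inI. }
  apply filterlim_locally. intros eps.
  destruct (Hc eps (cond_pos eps)) as [d [Hd H']].
  exists (mkposreal d Hd). intros y Hy.
  destruct (Req_dec (clamp x) (clamp y)) as [E|E].
  - rewrite E. apply ball_center.
  - apply H'. split; [split; [apply clamp_inI|exact E]|].
    apply Rle_lt_trans with (2 := Hy). apply clamp_lipschitz.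
Qed.

Lemma contI_const (c : R) : contI (fun _ => c).
Proof. intros x. apply continuous_const. Qed.

Lemma contI_id : contI (fun x => x).
Proof. apply contI_continuous. intros; apply continuous_id. Qed.

Lemma contI_plus (f g : R -> R) :
  contI f -> contI g -> contI (fun x => f x + g x).
Proof.
  intros Hf Hg x.
  apply (continuous_plus (fun y => f (clamp y)) (fun y => g (clamp y))); auto.
Qed.

Lemma contI_minus (f g : R -> R) :
  contI f -> contI g -> contI (fun x => f x - g x).
Proof.
  intros Hf Hg x.
  apply (continuous_minus (fun y => f (clamp y)) (fun y => g (clamp y))); auto.
Qed.

Lemma contI_mult (f g : R -> R) :
  contI f -> contI g -> contI (fun x => f x * g x).
Proof.
  intros Hf Hg x.
  apply (continuous_mult (fun y => f (clamp y)) (fun y => g (clamp y))); auto.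
Qed.

Lemma contI_pow (f : R -> R) (n : nat) : contI f -> contI (fun x => f x ^ n).
Proof.
  intros Hf. induction n as [|n IH].
  - apply (contI_const 1).
  - apply (contI_mult f (fun x => f x ^ n)); assumption.
Qed.

Lemma contI_comp (h f : R -> R) :
  (forall x, continuous h x) -> contI f -> contI (fun x => h (f x)).
Proof. intros Hh Hf x. apply (continuous_comp (fun y => f (clamp y)) h); auto. Qed.

(** With [clamp] inside, the integrand is continuous on the whole line, so integrability and the
    fundamental theorem need no care at the endpoints. *)
Definition integ (g : R -> R) : R := RInt (fun x => g (clamp x)) 0 1.

Lemma contI_ex_RInt (g : R -> R) (x y : R) :
  contI g -> ex_RInt (fun t => g (clamp t)) x y.
Proof. intros H. apply (@ex_RInt_continuous R_CompleteNormedModule). intros; apply H. Qed.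

Lemma integral01_integ (g : R -> R) : contI g -> integral01 g = integ g.
Proof.
  intros Hg. unfold integral01.
  assert (He : ex_RInt g 0 1).
  { apply ex_RInt_ext with (fun t => g (clamp t)); [|now apply contI_ex_RInt].
    intros x Hx. rewrite Rmin_left, Rmax_right in Hx by lra.
    rewrite clamp_id; [reflexivity|unfold inI; lra]. }
  assert (Hv : forall l, (exists pr : Riemann_integrable g 0 1, RiemannInt pr = l) -> l = integ g).
  { intros l [pr <-]. rewrite <- RInt_Reals. apply RInt_ext.
    intros x Hx. rewrite Rmin_left, Rmax_right in Hx by lra.
    rewrite clamp_id; [reflexivity|unfold inI; lra]. }
  apply Hv. apply epsilon_spec.
  exists (RiemannInt (ex_RInt_Reals_0 _ _ _ He)).
  exists (ex_RInt_Reals_0 _ _ _ He). reflexivity.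
Qed.

Lemma integ_ext (f g : R -> R) :
  (forall x, inI x -> f x = g x) -> integ f = integ g.
Proof. intros H. apply RInt_ext. intros x _. apply H, clamp_inI. Qed.

Lemma integ_plus (f g : R -> R) : contI f -> contI g ->
  integ (fun x => f x + g x) = integ f + integ g.
Proof.
  intros Hf Hg.
  apply (RInt_plus (fun x => f (clamp x)) (fun x => g (clamp x)));
    apply contI_ex_RInt; auto.
Qed.

Lemma integ_minus (f g : R -> R) : contI f -> contI g ->
  integ (fun x => f x - g x) = integ f - integ g.
Proof.
  intros Hf Hg.
  apply (RInt_minus (fun x => f (clamp x)) (fun x => g (clamp x)));
    apply contI_ex_RInt; auto.
Qed.

Lemma integ_scal (c : R) (f : R -> R) : contI f ->
  integ (fun x => c * f x) = c * integ f.
Proof. intros Hf. apply (RInt_scal (fun x => f (clamp x))); apply contI_ex_RInt; auto. Qed.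

Lemma integ_le (f g : R -> R) : contI f -> contI g ->
  (forall x, inI x -> f x <= g x) -> integ f <= integ g.
Proof.
  intros Hf Hg H. apply RInt_le; [lra| | |]; try (apply contI_ex_RInt; auto).
  intros x _. apply H, clamp_inI.
Qed.

Lemma integ_ge0 (f : R -> R) : contI f ->
  (forall x, inI x -> 0 <= f x) -> 0 <= integ f.
Proof.
  intros Hf H.
  replace 0 with (integ (fun _ => 0)).
  - apply integ_le; auto. apply contI_const.
  - unfold integ. rewrite RInt_const. unfold scal; simpl; unfold mult; simpl; ring.
Qed.

Lemma integ_deriv (h dh : R -> R) :
  (forall x, inI x -> deriv_within h x (dh x)) -> contI dh ->
  integ dh = h 1 - h 0.
Proof.
  intros Hd Hc.
  pose proof (contI_deriv h dh Hd) as Hh.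
  set (G := fun x => RInt (fun t => dh (clamp t)) 0 x).
  assert (HG : forall x, is_derive G x (dh (clamp x))).
  { intros x. apply (is_derive_RInt (fun t => dh (clamp t)) G 0 x); [|apply Hc].
    apply filter_forall. intros y.
    apply (@RInt_correct R_CompleteNormedModule (fun t => dh (clamp t)) 0 y).
    apply contI_ex_RInt, Hc. }
  (* The mean value theorem asks for a derivative only in the open interval, where [clamp] is
     locally the identity and the one-sided notion is the usual one; at the endpoints continuity
     suffices. *)
  destruct (MVT_gen (fun x => minus (G x) (h (clamp x))) 0 1 (fun _ => 0)) as [c [_ E]].
  - rewrite Rmin_left, Rmax_right by lra. intros x Hx.
    replace 0 with (minus (dh (clamp x)) (dh x)).
    2:{ rewrite clamp_id by (unfold inI; lra). apply (@minus_eq_zero R_AbelianGroup). }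
    apply (@is_derive_minus R_AbsRing); [apply HG|].
    apply is_derive_Reals. intros eps Heps.
    destruct (Hd x (conj (Rlt_le _ _ (proj1 Hx)) (Rlt_le _ _ (proj2 Hx))) eps Heps)
      as [d [Hdp H']].
    assert (Hm : 0 < Rmin d (Rmin x (1 - x))) by (repeat apply Rmin_glb_lt; lra).
    exists (mkposreal _ Hm). simpl. intros k Hk Hlt.
    assert (Hk1 : Rabs k < d) by (eapply Rlt_le_trans; [exact Hlt|apply Rmin_l]).
    assert (Hk2 : Rabs k < x).
    { eapply Rlt_le_trans; [exact Hlt|]. eapply Rle_trans; [apply Rmin_r|apply Rmin_l]. }
    assert (Hk3 : Rabs k < 1 - x).
    { eapply Rlt_le_trans; [exact Hlt|]. eapply Rle_trans; [apply Rmin_r|apply Rmin_r]. }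
    apply Rabs_def2 in Hk2. apply Rabs_def2 in Hk3.
    rewrite !clamp_id by (unfold inI; lra).
    specialize (H' (x + k)). simpl in H'. unfold Rdist in H'.
    replace (x + k - x) with k in H' by ring. apply H'.
    split; [split; [unfold inI; lra|lra]|exact Hk1].
  - intros x _. apply continuity_pt_filterlim.
    apply (continuous_minus G (fun y => h (clamp y))); [|apply Hh].
    apply (@ex_derive_continuous R_AbsRing). exists (dh (clamp x)). apply HG.
  - unfold G, minus, plus, opp in E; simpl in E. rewrite RInt_point in E.
    unfold zero in E; simpl in E.
    rewrite !clamp_id in E by (unfold inI; lra). unfold integ. lra.
Qed.

(** * Higher derivatives of the equation *)

Lemma deriv_within_shift_pow (k : nat) (x : R) :
  deriv_within (fun y => (y - 1) ^ S k) x (INR (S k) * (x - 1) ^ k).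
Proof.
  assert (H1 : deriv_within (fun y => y - 1) x (1 + 0)).
  { apply (deriv_within_plus (fun y => y) (fun _ => - (1))).
    - apply deriv_within_id.
    - apply deriv_within_const. }
  rewrite Rplus_0_r in H1.
  induction k as [|k IH].
  - intros eps Heps. destruct (H1 eps Heps) as [d [Hd H']].
    exists d; split; [exact Hd|]. intros y Hy.
    replace (((y - 1) ^ 1 - (x - 1) ^ 1) / (y - x)) with ((y - 1 - (x - 1)) / (y - x))
      by (f_equal; ring).
    replace (INR 1 * (x - 1) ^ 0) with 1 by (simpl; ring). apply H', Hy.
  - replace (INR (S (S k)) * (x - 1) ^ S k)
      with (1 * (x - 1) ^ S k + (x - 1) * (INR (S k) * (x - 1) ^ k))
      by (rewrite (S_INR (S k)); simpl pow; ring).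
    apply (deriv_within_mult (fun y => y - 1) (fun y => (y - 1) ^ S k)); assumption.
Qed.

Lemma deriv_within_taylor_sum (c : nat -> R) (m : nat) (x : R) :
  deriv_within (fun y => sumR m (fun i => (y - 1) ^ i / INR (fact i) * c i)) x
    (sumR (pred m) (fun i => (x - 1) ^ i / INR (fact i) * c (S i))).
Proof.
  induction m as [|m IH].
  - apply (deriv_within_const 0 x).
  - destruct m as [|m].
    + apply (deriv_within_const (0 + 1 / 1 * c O) x).
    + simpl pred in *.
      change (sumR (S m) (fun i => (x - 1) ^ i / INR (fact i) * c (S i)))
        with (sumR m (fun i => (x - 1) ^ i / INR (fact i) * c (S i))
              + (x - 1) ^ m / INR (fact m) * c (S m)).
      apply (deriv_within_plus
        (fun y => sumR (S m) (fun i => (y - 1) ^ i / INR (fact i) * c i))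
        (fun y => (y - 1) ^ S m / INR (fact (S m)) * c (S m))); [exact IH|].
      pose proof (INR_fact_neq_0 m).
      assert (INR (S m) <> 0) by (apply not_0_INR; discriminate).
      replace ((x - 1) ^ m / INR (fact m) * c (S m))
        with (INR (S m) * (x - 1) ^ m * (/ INR (fact (S m)) * c (S m))
              + (x - 1) ^ S m * 0)
        by (rewrite fact_simpl, mult_INR; field; auto).
      assert (Hd := deriv_within_mult _ (fun _ => / INR (fact (S m)) * c (S m)) x _ _
        (deriv_within_shift_pow m x) (deriv_within_const _ x)).
      intros eps Heps. destruct (Hd eps Heps) as [d [Hdp H']].
      exists d; split; [exact Hdp|]. intros y Hy.
      unfold Rdiv at 2 3. rewrite !Rmult_assoc. rewrite !Rmult_assoc in H'. apply H', Hy.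
Qed.

Ltac dwithin :=
  repeat first
    [ apply deriv_within_const | apply deriv_within_id
    | apply deriv_within_taylor_sum
    | apply deriv_within_plus | apply deriv_within_mult
    | match goal with H : smooth_seq _ |- _ => apply H; assumption end ].

(** Since kappa x + x^2 is quadratic with second derivative 2, the Leibniz rule for its product with
    u' has three terms, the last one contributing n(n+1) u^(n). Each derivative removes one term of
    the Taylor sum, so with truncated subtraction the sum is empty from n = N on. *)
Lemma ode_derivatives (N : nat) (lambda kappa a b : R) (D E G : nat -> R -> R) :
  smooth_seq D -> smooth_seq E -> smooth_seq G ->
  (forall x, inI x ->
     (kappa + 2 * x) * D 1%nat x + (kappa * x + x ^ 2) * D 2%nat x
     + (a * D 1%nat x - b * E 1%nat x)
     - INR N * (INR N + 1) * D 0%nat x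
     + lambda * sumR N (fun i => (x - 1) ^ i / INR (fact i) * D (S i) 1)
     = G 0%nat x) ->
  forall n x, inI x ->
     (kappa * x + x ^ 2) * D (S (S n)) x
     + (INR n + 1) * (kappa + 2 * x) * D (S n) x
     + (a * D (S n) x - b * E (S n) x)
     + (INR n * (INR n + 1) - INR N * (INR N + 1)) * D n x
     + lambda * sumR (N - n) (fun i => (x - 1) ^ i / INR (fact i) * D (S (n + i)) 1)
     = G n x.
Proof.
  intros HD HE HG H0 n.
  induction n as [|n IH]; intros x Hx.
  - rewrite <- (H0 x Hx), Nat.sub_0_r. simpl INR.
    change (fun i => (x - 1) ^ i / INR (fact i) * D (S (0 + i)%nat) 1)
      with (fun i => (x - 1) ^ i / INR (fact i) * D (S i) 1).
    set (X := sumR N _). ring.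
  - refine (deriv_within_unique (G n) x _ _ Hx _ (HG n x Hx)).
    eapply (deriv_within_eq (fun y =>
      (kappa * y + y * y) * D (S (S n)) y
      + (INR n + 1) * (kappa + 2 * y) * D (S n) y
      + (a * D (S n) y + (- b) * E (S n) y)
      + (INR n * (INR n + 1) + - (INR N * (INR N + 1))) * D n y
      + lambda * sumR (N - n) (fun i => (y - 1) ^ i / INR (fact i) * D (S (n + i)) 1)));
      [|exact Hx| |dwithin].
    + intros y Hy. rewrite <- (IH y Hy). set (X := sumR _ _). ring.
    + cbv beta. replace (N - S n)%nat with (pred (N - n)) by lia.
      rewrite S_INR.
      replace (sumR (pred (N - n)) (fun i => (x - 1) ^ i / INR (fact i) * D (S (S n + i)) 1))
        with (sumR (pred (N - n)) (fun i => (x - 1) ^ i / INR (fact i) * D (S (n + S i)) 1)).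
      2:{ generalize (pred (N - n)); intros m. induction m as [|m IHm]; [reflexivity|].
          simpl sumR. rewrite IHm, Nat.add_succ_r. reflexivity. }
      set (X := sumR _ _). ring.
Qed.

(** * The cutoff and the coefficient of the imaginary cross terms *)

(** For [T0 < T1] this is piecewise linear: [L] up to [T0], zero from [T1] on, slope -L/(T1-T0) in
    between. The Lipschitz bound makes the passage from T_n to T_{n+1} an error of order 1/n. *)
Definition cutoff (L T0 T1 T : R) : R := L * clamp ((T1 - T) / (T1 - T0)).

Definition cross_max (sigma T : R) : R := Rmax (T ^ 2 / (4 * sigma)) sigma.

Lemma cutoff_bounds (L T0 T1 T : R) : 0 <= L -> 0 <= cutoff L T0 T1 T <= L.
Proof. intros HL. unfold cutoff. destruct (clamp_inI ((T1 - T) / (T1 - T0))). nra. Qed.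

Lemma cutoff_vanish (L T0 T1 T : R) : T0 < T1 -> T1 <= T -> cutoff L T0 T1 T = 0.
Proof.
  intros H01 HT. unfold cutoff, clamp.
  assert ((T1 - T) / (T1 - T0) <= 0).
  { apply Rmult_le_reg_r with (T1 - T0); [lra|]. field_simplify; lra. }
  rewrite Rmin_right, Rmax_left by lra. ring.
Qed.

Lemma cutoff_top (L T0 T1 T : R) : T0 < T1 -> T <= T0 -> cutoff L T0 T1 T = L.
Proof.
  intros H01 HT. unfold cutoff, clamp.
  assert (1 <= (T1 - T) / (T1 - T0)).
  { apply Rmult_le_reg_r with (T1 - T0); [lra|]. field_simplify; lra. }
  rewrite Rmin_left, Rmax_right by lra. ring.
Qed.

Lemma cutoff_lipschitz (L T0 T1 T T' : R) : 0 <= L -> T0 < T1 -> T <= T' ->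
  cutoff L T0 T1 T' <= cutoff L T0 T1 T <= cutoff L T0 T1 T' + L / (T1 - T0) * (T' - T).
Proof.
  intros HL H01 HT. unfold cutoff.
  assert (Hd : 0 <= (T' - T) / (T1 - T0)).
  { apply Rmult_le_pos; [lra|]. apply Rlt_le, Rinv_0_lt_compat. lra. }
  assert (E : (T1 - T) / (T1 - T0) = (T1 - T') / (T1 - T0) + (T' - T) / (T1 - T0))
    by (field; lra).
  replace (L / (T1 - T0) * (T' - T)) with (L * ((T' - T) / (T1 - T0))) by (field; lra).
  rewrite E. generalize dependent ((T' - T) / (T1 - T0)).
  generalize ((T1 - T') / (T1 - T0)). intros z d Hd _.
  assert (clamp z <= clamp (z + d) <= clamp z + d).
  { unfold clamp, Rmax, Rmin; repeat destruct Rle_dec; lra. }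
  rewrite <- Rmult_plus_distr_l. split; apply Rmult_le_compat_l; lra.
Qed.

Lemma cross_max_pos (sigma T : R) : 0 < sigma -> 0 < cross_max sigma T.
Proof. intros H. apply Rlt_le_trans with sigma; [exact H|apply Rmax_r]. Qed.

Lemma cross_max_incr (sigma T T' : R) : 0 < sigma -> 0 <= T -> T <= T' ->
  cross_max sigma T <= cross_max sigma T'.
Proof.
  intros Hs HT HTT. apply Rle_max_compat_r. apply Rmult_le_compat_r.
  - apply Rlt_le, Rinv_0_lt_compat; lra.
  - nra.
Qed.

(** Numerator of the O(1/n) error: the first summand pays for replacing [nu * (nu + 1)] by [nu ^ 2],
    the second for moving the cutoff from T_n to T_{n+1}. *)
Definition shift_err (sigma L T0 T1 : R) : R :=
  L * (T1 ^ 2 / (4 * sigma)) + L / (T1 - T0) * T1 * cross_max sigma T1.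

(** Beyond [T1] the left side vanishes. Below it, [nu * k < T1] bounds the increment [k] by
    [T1 / nu], and the Lipschitz bound of the cutoff applies, [cross_max] being increasing. *)
Lemma cutoff_cross_max_shift (sigma L T0 T1 nu k : R) :
  0 < sigma -> 0 <= L -> T0 < T1 -> 0 < T1 -> 1 <= nu -> 0 <= k ->
  cutoff L T0 T1 (nu * k) * cross_max sigma (nu * k) <=
  cutoff L T0 T1 ((nu + 1) * k) * cross_max sigma ((nu + 1) * k)
    + L / (T1 - T0) * T1 * cross_max sigma T1 / nu.
Proof.
  intros Hs HL H01 HT1 Hnu Hk.
  set (Y := L / (T1 - T0) * T1 * cross_max sigma T1 / nu).
  assert (HLam : 0 <= L / (T1 - T0)).
  { apply Rmult_le_pos; [lra|]. apply Rlt_le, Rinv_0_lt_compat. lra. }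
  pose proof (cross_max_pos sigma T1 Hs) as Hm1.
  assert (HY : 0 <= Y).
  { unfold Y. apply Rdiv_le_0_compat; [|lra].
    apply Rmult_le_pos; [apply Rmult_le_pos|]; lra. }
  assert (HT : nu * k <= (nu + 1) * k) by nra.
  assert (HTp : 0 <= nu * k) by nra.
  pose proof (cutoff_bounds L T0 T1 ((nu + 1) * k) HL) as [Hb _].
  pose proof (cross_max_pos sigma ((nu + 1) * k) Hs).
  destruct (Rle_or_lt T1 (nu * k)) as [Hc|Hc].
  - rewrite (cutoff_vanish _ _ _ (nu * k)) by assumption. nra.
  - pose proof (cutoff_lipschitz L T0 T1 _ _ HL H01 HT) as [_ H2].
    replace ((nu + 1) * k - nu * k) with k in H2 by ring.
    pose proof (cross_max_incr sigma _ _ Hs HTp HT) as H3.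
    pose proof (cross_max_incr sigma _ _ Hs HTp (Rlt_le _ _ Hc)) as H4.
    pose proof (cross_max_pos sigma (nu * k) Hs) as H5.
    assert (H6 : k <= T1 / nu).
    { apply Rmult_le_reg_r with nu; [lra|]. field_simplify; lra. }
    assert (H7 : L / (T1 - T0) * k * cross_max sigma (nu * k) <= Y).
    { replace Y with (L / (T1 - T0) * (T1 / nu) * cross_max sigma T1)
        by (unfold Y; field; lra).
      apply Rmult_le_compat; try lra; [nra|]. apply Rmult_le_compat_l; lra. }
    set (lam := L / (T1 - T0)) in *.
    apply Rle_trans with
      ((cutoff L T0 T1 ((nu + 1) * k) + lam * k) * cross_max sigma (nu * k)).
    + apply Rmult_le_compat_r; lra.
    + rewrite Rmult_plus_distr_r. apply Rplus_le_compat; [|exact H7].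
      apply Rmult_le_compat_l; lra.
Qed.

(** [K] is a difference of two nonnegative terms, each at most the cutoff times [cross_max] up to
    O(1/nu). Two forms are needed because the cross term is split evenly between |V_n|^2 and
    |V_{n+1}|^2, and each half must be weighted at its own T. *)
Lemma coef_bound (sigma L T0 T1 nu kappa x c : R) :
  0 < sigma -> 0 <= L -> T0 < T1 -> 0 < T1 -> 1 <= nu -> 0 <= kappa -> 0 <= x ->
  0 <= c <= 1 ->
  let T := nu * (kappa + 2 * x) in
  let T' := (nu + 1) * (kappa + 2 * x) in
  let K := nu * (nu + 1) / sigma * (kappa * x + x ^ 2) * cutoff L T0 T1 T
           - c * sigma * cutoff L T0 T1 T' in
  Rabs K <= cutoff L T0 T1 T * cross_max sigma T + shift_err sigma L T0 T1 / nu /\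
  Rabs K <= cutoff L T0 T1 T' * cross_max sigma T' + shift_err sigma L T0 T1 / nu.
Proof.
  intros Hs HL H01 HT1 Hnu Hk Hx Hc T T' K.
  set (k := kappa + 2 * x) in *.
  assert (Hkp : 0 <= k) by (unfold k; lra).
  pose proof (cutoff_bounds L T0 T1 T HL) as [Hb1 Hb2].
  pose proof (cutoff_bounds L T0 T1 T' HL) as [Hb1' Hb2'].
  assert (HTT : T <= T') by (unfold T, T'; nra).
  assert (HT : 0 <= T) by (unfold T; nra).
  pose proof (cutoff_lipschitz L T0 T1 _ _ HL H01 HTT) as [H2 _].
  pose proof (cutoff_cross_max_shift sigma L T0 T1 nu k Hs HL H01 HT1 Hnu Hkp) as Hsh.
  fold T T' in Hsh.
  set (m := cutoff L T0 T1 T) in *. set (m' := cutoff L T0 T1 T') in *.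
  set (Y2 := L / (T1 - T0) * T1 * cross_max sigma T1 / nu) in *.
  assert (Hinu : 0 < / nu) by (apply Rinv_0_lt_compat; lra).
  assert (His : 0 < / (4 * sigma)) by (apply Rinv_0_lt_compat; lra).
  set (Y1 := L * (T1 ^ 2 / (4 * sigma)) / nu).
  assert (HY1 : 0 <= Y1).
  { unfold Y1, Rdiv. repeat apply Rmult_le_pos; lra. }
  assert (HLam : 0 <= L / (T1 - T0)).
  { apply Rmult_le_pos; [lra|]. apply Rlt_le, Rinv_0_lt_compat. lra. }
  pose proof (cross_max_pos sigma T1 Hs) as Hm1.
  assert (HY2 : 0 <= Y2).
  { unfold Y2. apply Rdiv_le_0_compat; [|lra].
    apply Rmult_le_pos; [apply Rmult_le_pos|]; lra. }
  assert (HE : shift_err sigma L T0 T1 / nu = Y1 + Y2)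
    by (unfold shift_err, Y1, Y2; field; lra).
  rewrite HE.
  (* Here kappa x + x^2 = (kappa + 2x)^2/4 - kappa^2/4. *)
  assert (Hq1 : nu ^ 2 * (kappa * x + x ^ 2) / sigma <= T ^ 2 / (4 * sigma)).
  { replace (T ^ 2 / (4 * sigma))
      with (nu ^ 2 * (kappa * x + x ^ 2) / sigma + nu ^ 2 * kappa ^ 2 * / (4 * sigma))
      by (unfold T, k; field; lra).
    assert (0 <= nu ^ 2 * kappa ^ 2 * / (4 * sigma)).
    { apply Rmult_le_pos; [|lra]. apply Rmult_le_pos; apply pow2_ge_0. }
    lra. }
  assert (Hq0 : 0 <= nu ^ 2 * (kappa * x + x ^ 2) / sigma).
  { apply Rdiv_le_0_compat; [|lra].
    apply Rmult_le_pos; [apply pow2_ge_0|nra]. }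
  set (w := nu ^ 2 * (kappa * x + x ^ 2) / sigma) in *.
  assert (HA : nu * (nu + 1) / sigma * (kappa * x + x ^ 2) * m = w * m + w * m / nu)
    by (unfold w; field; lra).
  assert (HmT : T ^ 2 / (4 * sigma) <= cross_max sigma T) by apply Rmax_l.
  assert (HmS : sigma <= cross_max sigma T) by apply Rmax_r.
  assert (HwY : w * m / nu <= Y1).
  { unfold Y1. apply Rmult_le_compat_r; [lra|].
    destruct (Rle_or_lt T1 T) as [Hd|Hd].
    - unfold m. rewrite cutoff_vanish, Rmult_0_r by assumption.
      apply Rmult_le_pos; [lra|]. apply Rdiv_le_0_compat; [apply pow2_ge_0|lra].
    - rewrite Rmult_comm. apply Rmult_le_compat; try lra.
      eapply Rle_trans; [exact Hq1|]. apply Rmult_le_compat_r; [lra|nra]. }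
  assert (Hwm : w * m <= m * cross_max sigma T) by nra.
  assert (Hwm0 : 0 <= w * m) by nra.
  assert (Hwm0' : 0 <= w * m / nu) by (apply Rmult_le_pos; lra).
  assert (HB : c * sigma * m' <= m * cross_max sigma T).
  { apply Rle_trans with (sigma * m'); [|nra].
    rewrite Rmult_assoc. assert (0 <= sigma * m') by nra. nra. }
  assert (HB0 : 0 <= c * sigma * m') by (apply Rmult_le_pos; [nra|lra]).
  assert (HB' : c * sigma * m' <= m' * cross_max sigma T').
  { assert (sigma <= cross_max sigma T') by apply Rmax_r.
    apply Rle_trans with (sigma * m'); [|nra].
    rewrite Rmult_assoc. assert (0 <= sigma * m') by nra. nra. }
  unfold K. rewrite HA. split; apply Rabs_le; lra.
Qed.

(** * Pointwise inequalities from the three multipliers *)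

(** Here V_{n-1}, V_n, V_{n+1} are (p0,q0), (p,q), (p1,q1) and nu = n+1. The real part of the
    equation times conj V_n is added to [eps * m] times the imaginary part. The bracket on the left
    is an exact derivative, the two brackets on the right are the flux at n and n+1. Of the margin 2
    delta, one delta is kept, delta/4 goes to each of the two forcing terms, delta/4 to the O(1/n)
    part of the cross term, and delta/4 remains in the flux to absorb the cross term coming from
    index n-1. *)
Lemma multiplier_pointwise
  (sigma L T0 T1 alpha beta delta nu kappa x a b eps c c'
   p q p1 q1 p0 q0 fr fi : R) :
  0 < sigma -> 0 <= L -> T0 < T1 -> 0 < T1 -> 0 < delta -> 1 <= nu ->
  0 <= kappa -> 0 <= x -> 0 <= c' <= 1 -> eps ^ 2 = 1 ->
  - alpha <= a -> beta <= eps * b ->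
  let w := kappa * x + x ^ 2 in
  let T := nu * (kappa + 2 * x) in
  let T' := (nu + 1) * (kappa + 2 * x) in
  let m := cutoff L T0 T1 T in
  let m' := cutoff L T0 T1 T' in
  2 * delta <= T - T / (2 * nu) - alpha + m * (beta - cross_max sigma T) ->
  shift_err sigma L T0 T1 / nu <= delta / 2 ->
  nu * (nu + 1) / sigma * w * p1 + T * p + (a * p - b * q) + c * sigma * p0 = fr ->
  nu * (nu + 1) / sigma * w * q1 + T * q + (a * q + b * p) + c * sigma * q0 = fi ->
  delta * (p ^ 2 + q ^ 2)
  + ((kappa + 2 * x) / 2 * (p ^ 2 + q ^ 2)
     + nu * (nu + 1) / sigma * w * (p1 * p + q1 * q) + c * sigma * (p0 * p + q0 * q))
  <= (1 + L ^ 2) / delta * (fr ^ 2 + fi ^ 2)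
     + (eps * c * sigma * m * (q * p0 - p * q0)
        - (m * cross_max sigma T / 2 + delta / 4) * (p ^ 2 + q ^ 2))
     - (eps * c' * sigma * m' * (q1 * p - p1 * q)
        - (m' * cross_max sigma T' / 2 + delta / 4) * (p1 ^ 2 + q1 ^ 2)).
Proof.
  intros Hs HL H01 HT1 Hd Hnu Hk Hx Hc Heps Ha Hb w T T' m m' Hbr HE Er Ei.
  destruct (coef_bound sigma L T0 T1 nu kappa x c' Hs HL H01 HT1 Hnu Hk Hx Hc)
    as [HK1 HK2].
  fold T T' w in HK1, HK2. fold m m' in HK1, HK2.
  set (K := nu * (nu + 1) / sigma * w * m - c' * sigma * m') in *.
  pose proof (cutoff_bounds L T0 T1 T HL) as [Hm0 HmL]. fold m in Hm0, HmL.
  set (S := p ^ 2 + q ^ 2). set (S1 := p1 ^ 2 + q1 ^ 2). set (F := fr ^ 2 + fi ^ 2).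
  assert (HS : 0 <= S) by (unfold S; nra).
  assert (HS1 : 0 <= S1) by (unfold S1; nra).
  assert (HF : 0 <= F) by (unfold F; nra).
  set (J := q1 * p - p1 * q). set (J0 := q * p0 - p * q0).
  assert (Habse : Rabs eps = 1).
  { assert (Hq : Rabs eps ^ 2 = 1) by (rewrite pow2_abs; exact Heps).
    pose proof (Rabs_pos eps). nra. }
  assert (HJ : Rabs J <= (S + S1) / 2).
  { pose proof (pow2_ge_0 (q1 - p)). pose proof (pow2_ge_0 (p1 + q)).
    pose proof (pow2_ge_0 (q1 + p)). pose proof (pow2_ge_0 (p1 - q)).
    unfold J, S, S1. apply Rabs_le. split; lra. }
  (* Each of the two halves of |K| |J| uses the bound of [K] at the matching T. *)
  assert (HKJ : - (eps * K * J) <= (m * cross_max sigma T / 2 + delta / 4) * S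
                                  + (m' * cross_max sigma T' / 2 + delta / 4) * S1).
  { apply Rle_trans with (Rabs (eps * K * J)).
    { rewrite <- Rabs_Ropp. apply Rle_abs. }
    rewrite !Rabs_mult, Habse, Rmult_1_l.
    apply Rle_trans with (Rabs K * ((S + S1) / 2)).
    { apply Rmult_le_compat_l; [apply Rabs_pos|exact HJ]. }
    assert (Rabs K * S <= (m * cross_max sigma T + delta / 2) * S)
      by (apply Rmult_le_compat_r; lra).
    assert (Rabs K * S1 <= (m' * cross_max sigma T' + delta / 2) * S1)
      by (apply Rmult_le_compat_r; lra).
    lra. }
  assert (Hre : nu * (nu + 1) / sigma * w * (p1 * p + q1 * q) + (T + a) * S
                + c * sigma * (p0 * p + q0 * q) = fr * p + fi * q)
    by (rewrite <- Er, <- Ei; unfold S; ring).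
  assert (Him : nu * (nu + 1) / sigma * w * J + b * S - c * sigma * J0
                = fi * p - fr * q)
    by (rewrite <- Er, <- Ei; unfold S, J, J0; ring).
  assert (Y : forall y z, y * z <= delta / 4 * z ^ 2 + / delta * y ^ 2).
  { intros y z.
    assert (0 <= / delta * (delta / 2 * z - y) ^ 2).
    { apply Rmult_le_pos; [apply Rlt_le, Rinv_0_lt_compat, Hd|apply pow2_ge_0]. }
    replace (delta / 4 * z ^ 2 + / delta * y ^ 2)
      with (/ delta * (delta / 2 * z - y) ^ 2 + y * z) by (field; lra). lra. }
  assert (HY1 : fr * p + fi * q <= delta / 4 * S + / delta * F).
  { pose proof (Y fr p). pose proof (Y fi q). unfold S, F. lra. }
  assert (Hid : 0 < / delta) by (apply Rinv_0_lt_compat, Hd).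
  assert (HY2 : eps * m * (fi * p - fr * q) <= delta / 4 * S + L ^ 2 * / delta * F).
  { pose proof (Y (eps * m * fi) p) as Y1. pose proof (Y (- (eps * m * fr)) q) as Y2.
    assert (/ delta * ((eps * m) ^ 2 * F) <= / delta * (L ^ 2 * F)).
    { apply Rmult_le_compat_l; [lra|]. apply Rmult_le_compat_r; [exact HF|].
      rewrite Rpow_mult_distr, Heps. nra. }
    replace ((eps * m * fi) ^ 2) with ((eps * m) ^ 2 * fi ^ 2) in Y1 by ring.
    replace ((- (eps * m * fr)) ^ 2) with ((eps * m) ^ 2 * fr ^ 2) in Y2 by ring.
    unfold S, F in *. lra. }
  assert (Hbr' : 2 * delta * S <= (T - T / (2 * nu) + a + m * (eps * b) - m * cross_max sigma T) * S).
  { apply Rmult_le_compat_r; [exact HS|].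
    assert (m * beta <= m * (eps * b)) by (apply Rmult_le_compat_l; lra). lra. }
  assert (HT2 : T / (2 * nu) * S = (kappa + 2 * x) / 2 * S)
    by (unfold T; field; lra).
  assert (Hsplit : eps * m * (nu * (nu + 1) / sigma * w * J)
                   = eps * K * J + eps * c' * sigma * m' * J) by (unfold K; ring).
  assert (Him' : eps * m * (nu * (nu + 1) / sigma * w * J)
                 = eps * m * (fi * p - fr * q) - m * (eps * b) * S + eps * c * sigma * m * J0).
  { rewrite <- Him. ring. }
  replace ((1 + L ^ 2) / delta * F) with (/ delta * F + L ^ 2 * / delta * F) by (field; lra).
  lra.
Qed.

(** The extra factor x removes every boundary contribution at 0; its derivative costs only the
    unweighted |V_{n-1}|^2, which is already controlled. The diagonal yields 2 n^2 x^2 |V_n|^2, of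
    which one half is spent on Re s and one half on the forcing. *)
Lemma weighted_pointwise
  (sigma alpha n kappa x a b c p q p1 q1 p0 q0 fr fi : R) :
  0 < sigma -> 1 <= n -> 0 <= kappa -> 0 <= x -> 0 <= c -> - alpha <= a ->
  let w := kappa * x + x ^ 2 in
  let nu := n + 1 in
  let T := nu * (kappa + 2 * x) in
  nu * (nu + 1) / sigma * w * p1 + T * p + (a * p - b * q) + c * sigma * p0 = fr ->
  nu * (nu + 1) / sigma * w * q1 + T * q + (a * q + b * p) + c * sigma * q0 = fi ->
  n ^ 2 * (x ^ 2 * (p ^ 2 + q ^ 2))
  + (nu * (2 * kappa * x + 3 * x ^ 2) / 2 * (p ^ 2 + q ^ 2)
     + nu * x * (nu * (nu + 1) / sigma * w * (p1 * p + q1 * q))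
     + c * sigma ^ 2 / (2 * n) * (p0 ^ 2 + q0 ^ 2)
     + nu * x * (c * sigma * (p0 * p + q0 * q)))
  <= 2 * alpha ^ 2 * (p ^ 2 + q ^ 2) + 2 * (fr ^ 2 + fi ^ 2)
     + sigma ^ 2 / 2 * (c * (p0 ^ 2 + q0 ^ 2)).
Proof.
  intros Hs Hn Hk Hx Hc Ha w nu T Er Ei.
  set (S := p ^ 2 + q ^ 2). set (S0 := p0 ^ 2 + q0 ^ 2). set (F := fr ^ 2 + fi ^ 2).
  assert (HS : 0 <= S) by (unfold S; nra).
  assert (HS0 : 0 <= S0) by (unfold S0; nra).
  assert (Hre : nu * x * (nu * (nu + 1) / sigma * w * (p1 * p + q1 * q))
                + nu * x * (T + a) * S
                + nu * x * (c * sigma * (p0 * p + q0 * q)) = nu * x * (fr * p + fi * q))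
    by (rewrite <- Er, <- Ei; unfold S; ring).
  assert (H0 : c * sigma ^ 2 / (2 * n) * S0 <= sigma ^ 2 / 2 * (c * S0)).
  { replace (c * sigma ^ 2 / (2 * n) * S0) with (sigma ^ 2 / 2 * (c * S0) * / n)
      by (field; lra).
    assert (/ n <= 1) by (rewrite <- Rinv_1; apply Rinv_le_contravar; lra).
    assert (0 <= sigma ^ 2 / 2 * (c * S0)).
    { apply Rmult_le_pos; [nra|apply Rmult_le_pos; lra]. }
    nra. }
  assert (HT : 2 * n ^ 2 * x ^ 2 * S
               <= nu * x * T * S - nu * (2 * kappa * x + 3 * x ^ 2) / 2 * S).
  { rewrite <- Rmult_minus_distr_r. apply Rmult_le_compat_r; [exact HS|].
    unfold T, nu.
    assert (0 <= kappa * x) by nra. assert (0 <= x ^ 2) by nra.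
    assert (0 <= n * (kappa * x)) by nra. assert (0 <= n * x ^ 2) by nra.
    assert (0 <= n * (n * (kappa * x))) by nra.
    replace ((n + 1) * x * ((n + 1) * (kappa + 2 * x)))
      with (n * (n * (kappa * x)) + 2 * (n * (kappa * x)) + kappa * x
            + 2 * (n ^ 2 * x ^ 2) + 4 * (n * x ^ 2) + 2 * x ^ 2) by ring.
    replace ((n + 1) * (2 * kappa * x + 3 * x ^ 2) / 2)
      with (n * (kappa * x) + kappa * x + 3 / 2 * (n * x ^ 2) + 3 / 2 * x ^ 2) by field.
    lra. }
  set (y := n * x).
  assert (Hy : 0 <= y) by (unfold y; nra).
  assert (Hnx : 0 <= nu * x <= 2 * y) by (unfold nu, y; nra).
  assert (HA : - (nu * x * a * S) <= (y ^ 2 / 2 + 2 * alpha ^ 2) * S).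
  { replace (- (nu * x * a * S)) with (- (nu * x * a) * S) by ring.
    apply Rmult_le_compat_r; [exact HS|].
    apply Rle_trans with (nu * x * Rabs alpha).
    - pose proof (Rle_abs alpha).
      replace (- (nu * x * a)) with (nu * x * (- a)) by ring.
      apply Rmult_le_compat_l; lra.
    - pose proof (Rabs_pos alpha). rewrite <- (pow2_abs alpha).
      set (A := Rabs alpha) in *.
      apply Rle_trans with (2 * y * A); [apply Rmult_le_compat_r; lra|].
      assert (0 <= (y - 2 * A) ^ 2) by apply pow2_ge_0. nra. }
  assert (Y : forall f v, nu * x * (f * v) <= y ^ 2 / 2 * v ^ 2 + 2 * f ^ 2).
  { intros f v. apply Rle_trans with (2 * y * Rabs (f * v)).
    - apply Rle_trans with (nu * x * Rabs (f * v)).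
      + apply Rmult_le_compat_l; [lra|apply Rle_abs].
      + apply Rmult_le_compat_r; [apply Rabs_pos|lra].
    - rewrite Rabs_mult, <- (pow2_abs f), <- (pow2_abs v).
      set (A := Rabs f). set (B := Rabs v).
      assert (0 <= (y * B - 2 * A) ^ 2) by apply pow2_ge_0. nra. }
  pose proof (Y fr p) as Y1. pose proof (Y fi q) as Y2.
  assert (HF : nu * x * (fr * p + fi * q) <= y ^ 2 / 2 * S + 2 * F)
    by (unfold S, F; lra).
  replace (n ^ 2 * (x ^ 2 * S)) with (y ^ 2 * S) by (unfold y; ring).
  replace (2 * n ^ 2 * x ^ 2 * S) with (2 * (y ^ 2 * S)) in HT by (unfold y; ring).
  lra.
Qed.

(** From |A + ib| |V_n| <= c sigma |V_{n-1}| + |F_n|, squared with a Young parameter [d] that turns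
    sigma^2 into the midpoint of sigma^2 and rho^2. This stays below rho^2, so the recursion can be
    summed over n. *)
Lemma boundary_pointwise
  (sigma rho A b c p q p0 q0 fr fi : R) :
  0 < sigma -> sigma < rho -> 0 <= c <= 1 -> rho ^ 2 <= A ^ 2 + b ^ 2 ->
  A * p - b * q + c * sigma * p0 = fr ->
  A * q + b * p + c * sigma * q0 = fi ->
  rho ^ 2 * (p ^ 2 + q ^ 2)
  <= (rho ^ 2 + sigma ^ 2) / 2 * (c * (p0 ^ 2 + q0 ^ 2))
     + (1 + 2 * sigma ^ 2 / (rho ^ 2 - sigma ^ 2)) * (fr ^ 2 + fi ^ 2).
Proof.
  intros Hs Hr Hc HA Er Ei.
  set (d := (rho ^ 2 - sigma ^ 2) / 2).
  assert (Hd : 0 < d) by (unfold d; nra).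
  apply Rle_trans with ((A ^ 2 + b ^ 2) * (p ^ 2 + q ^ 2)).
  { apply Rmult_le_compat_r; [nra|exact HA]. }
  replace ((A ^ 2 + b ^ 2) * (p ^ 2 + q ^ 2))
    with ((fr - c * sigma * p0) ^ 2 + (fi - c * sigma * q0) ^ 2)
    by (rewrite <- Er, <- Ei; ring).
  replace ((rho ^ 2 + sigma ^ 2) / 2) with (sigma ^ 2 + d) by (unfold d; field).
  replace (2 * sigma ^ 2 / (rho ^ 2 - sigma ^ 2)) with (sigma ^ 2 / d)
    by (unfold d; field; nra).
  assert (Y : forall f v, (f - c * sigma * v) ^ 2
    <= (sigma ^ 2 + d) * (c * v ^ 2) + (1 + sigma ^ 2 / d) * f ^ 2).
  { intros f v.
    assert (0 <= / d * (sigma * f + d * (c * v)) ^ 2).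
    { apply Rmult_le_pos; [apply Rlt_le, Rinv_0_lt_compat, Hd|apply pow2_ge_0]. }
    replace (/ d * (sigma * f + d * (c * v)) ^ 2)
      with (sigma ^ 2 / d * f ^ 2 + 2 * sigma * f * (c * v) + d * (c ^ 2 * v ^ 2))
      in H by (field; lra).
    assert (c ^ 2 * v ^ 2 <= c * v ^ 2) by (apply Rmult_le_compat_r; nra).
    assert ((sigma ^ 2 + d) * (c ^ 2 * v ^ 2) <= (sigma ^ 2 + d) * (c * v ^ 2))
      by (apply Rmult_le_compat_l; nra).
    lra. }
  pose proof (Y fr p0). pose proof (Y fi q0). lra.
Qed.

(** * The scaled system and its integrated estimates at a fixed index *)

Definition coefN (N n : nat) : R :=
  1 - INR N * (INR N + 1) / (INR n * (INR n + 1)).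

Lemma coefN_bounds (N n : nat) : (1 <= N <= n)%nat -> 0 <= coefN N n <= 1.
Proof.
  intros [H1 H2]. apply le_INR in H1, H2. simpl in H1. unfold coefN.
  set (y := INR N) in *. set (z := INR n) in *.
  assert (0 < z * (z + 1)) by nra.
  assert (0 <= y * (y + 1) / (z * (z + 1))) by (apply Rdiv_le_0_compat; nra).
  assert (y * (y + 1) / (z * (z + 1)) <= 1).
  { apply Rmult_le_reg_r with (z * (z + 1)); [assumption|].
    unfold Rdiv. rewrite Rmult_assoc, Rinv_l by lra. nra. }
  lra.
Qed.

Lemma coefN_diag (N : nat) : (1 <= N)%nat -> coefN N N = 0.
Proof. intros H. apply le_INR in H. simpl in H. unfold coefN. field. lra. Qed.

Record scaled_system (sigma kappa a b : R) (N : nat)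
    (Vr Vi Fr Fi : nat -> R -> R) : Prop := {
  ss_dVr : forall n x, inI x ->
    deriv_within (Vr n) x ((INR n + 1) * (INR n + 1 + 1) / sigma * Vr (S n) x);
  ss_dVi : forall n x, inI x ->
    deriv_within (Vi n) x ((INR n + 1) * (INR n + 1 + 1) / sigma * Vi (S n) x);
  ss_cFr : forall n, contI (Fr n);
  ss_cFi : forall n, contI (Fi n);
  ss_re : forall n x, (N <= n)%nat -> inI x ->
    (INR n + 1) * (INR n + 1 + 1) / sigma * (kappa * x + x ^ 2) * Vr (S n) x
    + (INR n + 1) * (kappa + 2 * x) * Vr n x + (a * Vr n x - b * Vi n x)
    + coefN N n * sigma * Vr (pred n) x = Fr n x;
  ss_im : forall n x, (N <= n)%nat -> inI x ->
    (INR n + 1) * (INR n + 1 + 1) / sigma * (kappa * x + x ^ 2) * Vi (S n) x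
    + (INR n + 1) * (kappa + 2 * x) * Vi n x + (a * Vi n x + b * Vr n x)
    + coefN N n * sigma * Vi (pred n) x = Fi n x }.

Definition energy (V W : nat -> R -> R) (n : nat) : R :=
  integ (fun x => V n x ^ 2 + W n x ^ 2).

Definition energy2 (V W : nat -> R -> R) (n : nat) : R :=
  INR n ^ 2 * integ (fun x => x ^ 2 * (V n x ^ 2 + W n x ^ 2)).

Definition trace0 (V W : nat -> R -> R) (n : nat) : R := V n 0 ^ 2 + W n 0 ^ 2.

(* The part of the combined estimate that telescopes in [n]; for [n = 0] the value of
   [pred n] is irrelevant, and for [n = N] the factor [coefN N N] vanishes. *)
Definition flux (sigma L T0 T1 delta kappa eps : R) (N : nat)
    (Vr Vi : nat -> R -> R) (n : nat) (x : R) : R :=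
  eps * coefN N n * sigma * cutoff L T0 T1 ((INR n + 1) * (kappa + 2 * x))
    * (Vi n x * Vr (pred n) x - Vr n x * Vi (pred n) x)
  - (cutoff L T0 T1 ((INR n + 1) * (kappa + 2 * x))
     * cross_max sigma ((INR n + 1) * (kappa + 2 * x)) / 2 + delta / 4)
    * (Vr n x ^ 2 + Vi n x ^ 2).

Ltac contI_solve :=
  lazymatch goal with
  | |- contI (fun _ => ?c) => apply (contI_const c)
  | |- contI (fun x => x) => apply contI_id
  | |- contI (fun x => @?f x + @?g x) => apply (contI_plus f g); contI_solve
  | |- contI (fun x => @?f x - @?g x) => apply (contI_minus f g); contI_solve
  | |- contI (fun x => @?f x * @?g x) => apply (contI_mult f g); contI_solve
  | |- contI (fun x => @?f x ^ ?n) => apply (contI_pow f n); contI_solve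
  | |- _ => first
      [ assumption
      | match goal with H : forall n : nat, contI _ |- _ => apply H end ]
  end.

Lemma cutoff_continuous (L T0 T1 T : R) : continuous (cutoff L T0 T1) T.
Proof.
  apply (continuous_mult (fun _ => L) (fun T => clamp ((T1 - T) / (T1 - T0)))).
  - apply continuous_const.
  - apply (continuous_comp (fun T => (T1 - T) / (T1 - T0)) clamp).
    + apply (continuous_mult (fun T => T1 - T) (fun _ => / (T1 - T0)));
        [|apply continuous_const].
      apply (continuous_minus (fun _ => T1) (fun T => T));
        [apply continuous_const|apply continuous_id].
    + apply (contI_continuous (fun y => y)). intros; apply continuous_id.
Qed.

Lemma cross_max_continuous (sigma T : R) : continuous (cross_max sigma) T.
Proof.
  apply continuous_ext with
    (fun T => (T ^ 2 / (4 * sigma) + sigma + Rabs (T ^ 2 / (4 * sigma) - sigma)) / 2).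
  { intros t. unfold cross_max, Rmax, Rabs. destruct Rle_dec, Rcase_abs; lra. }
  assert (H : continuous (fun T => T ^ 2 / (4 * sigma)) T).
  { apply (ex_derive_continuous (fun T => T ^ 2 / (4 * sigma))). auto_derive; auto. }
  apply (continuous_mult (fun T => T ^ 2 / (4 * sigma) + sigma
    + Rabs (T ^ 2 / (4 * sigma) - sigma)) (fun _ => / 2)); [|apply continuous_const].
  apply (continuous_plus (fun T => T ^ 2 / (4 * sigma) + sigma)
    (fun T => Rabs (T ^ 2 / (4 * sigma) - sigma))).
  - apply (continuous_plus (fun T => T ^ 2 / (4 * sigma)) (fun _ => sigma));
      [exact H|apply continuous_const].
  - apply (continuous_comp (fun T => T ^ 2 / (4 * sigma) - sigma) Rabs);
      [|apply continuous_Rabs].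
    apply (continuous_minus (fun T => T ^ 2 / (4 * sigma)) (fun _ => sigma));
      [exact H|apply continuous_const].
Qed.

Lemma flux_contI (sigma L T0 T1 delta kappa eps : R) (N : nat)
    (Vr Vi : nat -> R -> R) (n : nat) :
  (forall k, contI (Vr k)) -> (forall k, contI (Vi k)) ->
  contI (flux sigma L T0 T1 delta kappa eps N Vr Vi n).
Proof.
  intros H1 H2.
  assert (HT : contI (fun x => (INR n + 1) * (kappa + 2 * x))) by contI_solve.
  assert (Hmu : contI (fun x => cutoff L T0 T1 ((INR n + 1) * (kappa + 2 * x))))
    by (apply (contI_comp (cutoff L T0 T1)); [apply cutoff_continuous|exact HT]).
  assert (Hmm : contI (fun x => cross_max sigma ((INR n + 1) * (kappa + 2 * x))))
    by (apply (contI_comp (cross_max sigma)); [apply cross_max_continuous|exact HT]).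
  unfold flux, Rdiv. contI_solve.
Qed.

Lemma ss_contI (sigma kappa a b : R) (N : nat) (Vr Vi Fr Fi : nat -> R -> R) :
  scaled_system sigma kappa a b N Vr Vi Fr Fi ->
  (forall n, contI (Vr n)) /\ (forall n, contI (Vi n)).
Proof.
  intros HS. split; intros n; eapply contI_deriv;
    [exact (ss_dVr _ _ _ _ _ _ _ _ _ HS n)|exact (ss_dVi _ _ _ _ _ _ _ _ _ HS n)].
Qed.

Lemma energy_step (sigma L T0 T1 alpha beta delta kappa a b eps : R) (N n : nat)
    (Vr Vi Fr Fi : nat -> R -> R) :
  0 < sigma -> 0 <= L -> T0 < T1 -> 0 < T1 -> 0 < delta -> (1 <= N <= n)%nat ->
  0 <= kappa -> eps ^ 2 = 1 -> - alpha <= a -> beta <= eps * b ->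
  scaled_system sigma kappa a b N Vr Vi Fr Fi ->
  (forall T, 0 <= T ->
    2 * delta <= T - T / (2 * (INR n + 1)) - alpha
                 + cutoff L T0 T1 T * (beta - cross_max sigma T)) ->
  shift_err sigma L T0 T1 / (INR n + 1) <= delta / 2 ->
  delta * energy Vr Vi n <=
    (1 + L ^ 2) / delta * energy Fr Fi n
    + sigma ^ 2 / 2 * (coefN N n * trace0 Vr Vi (pred n))
    + integ (flux sigma L T0 T1 delta kappa eps N Vr Vi n)
    - integ (flux sigma L T0 T1 delta kappa eps N Vr Vi (S n)).
Proof.
  intros Hs HL H01 HT1 Hd HN Hk Heps Ha Hb HS Hbr HE.
  destruct (ss_contI _ _ _ _ _ _ _ _ _ HS) as [Cr Ci].
  pose proof (ss_cFr _ _ _ _ _ _ _ _ _ HS) as CFr.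
  pose proof (ss_cFi _ _ _ _ _ _ _ _ _ HS) as CFi.
  pose proof (coefN_bounds N n HN) as Hc.
  assert (Hc' : 0 <= coefN N (S n) <= 1) by (apply coefN_bounds; lia).
  assert (Hn : 1 <= INR n) by (apply (le_INR 1); lia).
  set (c := coefN N n) in *.
  (* Antiderivative of both real couplings; the second coefficient comes from V_{n-1}' =
     n(n+1)/sigma V_n. *)
  set (h := fun x => / 2 * (kappa * x + x * x) * (Vr n x * Vr n x + Vi n x * Vi n x)
    + c * sigma ^ 2 / (2 * INR n * (INR n + 1))
      * (Vr (pred n) x * Vr (pred n) x + Vi (pred n) x * Vi (pred n) x)).
  set (dh := fun x => (kappa + 2 * x) / 2 * (Vr n x ^ 2 + Vi n x ^ 2)
     + (INR n + 1) * (INR n + 1 + 1) / sigma * (kappa * x + x ^ 2)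
       * (Vr (S n) x * Vr n x + Vi (S n) x * Vi n x)
     + c * sigma * (Vr (pred n) x * Vr n x + Vi (pred n) x * Vi n x)).
  assert (Hh : forall x, inI x -> deriv_within h x (dh x)).
  { intros x Hx.
    assert (Dr := ss_dVr _ _ _ _ _ _ _ _ _ HS n x Hx).
    assert (Di := ss_dVi _ _ _ _ _ _ _ _ _ HS n x Hx).
    assert (Dr0 := ss_dVr _ _ _ _ _ _ _ _ _ HS (pred n) x Hx).
    assert (Di0 := ss_dVi _ _ _ _ _ _ _ _ _ HS (pred n) x Hx).
    destruct n as [|k]; [lia|]. simpl pred in *.
    replace (INR k + 1) with (INR (S k)) in Dr0, Di0 by (rewrite S_INR; ring).
    eapply (deriv_within_eq h); [reflexivity|exact Hx| |].
    2:{ unfold h. repeat first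
          [ exact Dr | exact Di | exact Dr0 | exact Di0
          | apply deriv_within_const | apply deriv_within_id
          | apply deriv_within_plus | apply deriv_within_mult ]. }
    unfold dh. cbv beta. field. lra. }
  assert (Cdh : contI dh) by (unfold dh, Rdiv; contI_solve).
  assert (Hint : integ dh = h 1 - h 0) by (apply integ_deriv; assumption).
  assert (Hpt : forall x, inI x ->
    delta * (Vr n x ^ 2 + Vi n x ^ 2) + dh x <=
    (1 + L ^ 2) / delta * (Fr n x ^ 2 + Fi n x ^ 2)
    + flux sigma L T0 T1 delta kappa eps N Vr Vi n x
    - flux sigma L T0 T1 delta kappa eps N Vr Vi (S n) x).
  { intros x Hx.
    pose proof (ss_re _ _ _ _ _ _ _ _ _ HS n x (proj2 HN) Hx) as Er.
    pose proof (ss_im _ _ _ _ _ _ _ _ _ HS n x (proj2 HN) Hx) as Ei.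
    assert (Hx0 : 0 <= x) by apply Hx.
    unfold flux. rewrite S_INR. simpl pred.
    apply (multiplier_pointwise sigma L T0 T1 alpha beta delta (INR n + 1) kappa x a b
      eps c (coefN N (S n))); try assumption; try lra.
    apply Hbr. nra. }
  assert (Cf := flux_contI sigma L T0 T1 delta kappa eps N Vr Vi n Cr Ci).
  assert (Cf' := flux_contI sigma L T0 T1 delta kappa eps N Vr Vi (S n) Cr Ci).
  apply integ_le in Hpt; [| contI_solve | contI_solve].
  rewrite integ_plus, integ_minus, integ_plus, !integ_scal in Hpt by contI_solve.
  fold (energy Vr Vi n) (energy Fr Fi n) in Hpt.
  (* The value at 1 has the favourable sign and is dropped. *)
  assert (H1 : 0 <= h 1).
  { unfold h. apply Rplus_le_le_0_compat.
    - apply Rmult_le_pos; nra.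
    - apply Rmult_le_pos; [apply Rdiv_le_0_compat; nra|nra]. }
  (* At 0 the factor kappa x + x^2 vanishes, so only the trace of V_{n-1} survives. *)
  assert (H0 : h 0 <= sigma ^ 2 / 2 * (c * trace0 Vr Vi (pred n))).
  { unfold h, trace0.
    set (Y := Vr (pred n) 0 ^ 2 + Vi (pred n) 0 ^ 2).
    assert (HY : 0 <= c * Y) by (apply Rmult_le_pos; [lra|unfold Y; nra]).
    match goal with |- ?l <= _ =>
      replace l with (sigma ^ 2 / 2 * (c * Y) * / (INR n * (INR n + 1)))
        by (unfold Y; field; lra) end.
    assert (/ (INR n * (INR n + 1)) <= 1)
      by (rewrite <- Rinv_1; apply Rinv_le_contravar; nra).
    assert (0 <= sigma ^ 2 / 2 * (c * Y)) by (apply Rmult_le_pos; nra).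
    nra. }
  change (integ (fun x => flux sigma L T0 T1 delta kappa eps N Vr Vi n x))
    with (integ (flux sigma L T0 T1 delta kappa eps N Vr Vi n)) in Hpt.
  change (integ (fun x => flux sigma L T0 T1 delta kappa eps N Vr Vi (S n) x))
    with (integ (flux sigma L T0 T1 delta kappa eps N Vr Vi (S n))) in Hpt.
  change (integ (fun x => dh x)) with (integ dh) in Hpt.
  lra.
Qed.

Lemma energy2_step (sigma alpha kappa a b : R) (N n : nat)
    (Vr Vi Fr Fi : nat -> R -> R) :
  0 < sigma -> (1 <= N <= n)%nat -> 0 <= kappa -> - alpha <= a ->
  scaled_system sigma kappa a b N Vr Vi Fr Fi ->
  energy2 Vr Vi n <=
    2 * alpha ^ 2 * energy Vr Vi n + 2 * energy Fr Fi n
    + sigma ^ 2 / 2 * (coefN N n * energy Vr Vi (pred n)).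
Proof.
  intros Hs HN Hk Ha HS.
  destruct (ss_contI _ _ _ _ _ _ _ _ _ HS) as [Cr Ci].
  pose proof (ss_cFr _ _ _ _ _ _ _ _ _ HS) as CFr.
  pose proof (ss_cFi _ _ _ _ _ _ _ _ _ HS) as CFi.
  pose proof (coefN_bounds N n HN) as Hc.
  assert (Hn : 1 <= INR n) by (apply (le_INR 1); lia).
  set (c := coefN N n) in *.
  set (h := fun x => (INR n + 1) / 2 * x * (kappa * x + x * x)
      * (Vr n x * Vr n x + Vi n x * Vi n x)
    + c * sigma ^ 2 / (2 * INR n) * x
      * (Vr (pred n) x * Vr (pred n) x + Vi (pred n) x * Vi (pred n) x)).
  set (dh := fun x =>
     (INR n + 1) * (2 * kappa * x + 3 * x ^ 2) / 2 * (Vr n x ^ 2 + Vi n x ^ 2)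
     + (INR n + 1) * x * ((INR n + 1) * (INR n + 1 + 1) / sigma * (kappa * x + x ^ 2)
       * (Vr (S n) x * Vr n x + Vi (S n) x * Vi n x))
     + c * sigma ^ 2 / (2 * INR n) * (Vr (pred n) x ^ 2 + Vi (pred n) x ^ 2)
     + (INR n + 1) * x * (c * sigma * (Vr (pred n) x * Vr n x + Vi (pred n) x * Vi n x))).
  assert (Hh : forall x, inI x -> deriv_within h x (dh x)).
  { intros x Hx.
    assert (Dr := ss_dVr _ _ _ _ _ _ _ _ _ HS n x Hx).
    assert (Di := ss_dVi _ _ _ _ _ _ _ _ _ HS n x Hx).
    assert (Dr0 := ss_dVr _ _ _ _ _ _ _ _ _ HS (pred n) x Hx).
    assert (Di0 := ss_dVi _ _ _ _ _ _ _ _ _ HS (pred n) x Hx).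
    destruct n as [|k]; [lia|]. simpl pred in *.
    replace (INR k + 1) with (INR (S k)) in Dr0, Di0 by (rewrite S_INR; ring).
    eapply (deriv_within_eq h); [reflexivity|exact Hx| |].
    2:{ unfold h. repeat first
          [ exact Dr | exact Di | exact Dr0 | exact Di0
          | apply deriv_within_const | apply deriv_within_id
          | apply deriv_within_plus | apply deriv_within_mult ]. }
    unfold dh. cbv beta. field. lra. }
  assert (Cdh : contI dh) by (unfold dh, Rdiv; contI_solve).
  assert (Hint : integ dh = h 1 - h 0) by (apply integ_deriv; assumption).
  assert (Hpt : forall x, inI x ->
    INR n ^ 2 * (x ^ 2 * (Vr n x ^ 2 + Vi n x ^ 2)) + dh x <=
    2 * alpha ^ 2 * (Vr n x ^ 2 + Vi n x ^ 2) + 2 * (Fr n x ^ 2 + Fi n x ^ 2)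
    + sigma ^ 2 / 2 * (c * (Vr (pred n) x ^ 2 + Vi (pred n) x ^ 2))).
  { intros x Hx.
    pose proof (ss_re _ _ _ _ _ _ _ _ _ HS n x (proj2 HN) Hx) as Er.
    pose proof (ss_im _ _ _ _ _ _ _ _ _ HS n x (proj2 HN) Hx) as Ei.
    assert (Hx0 : 0 <= x) by apply Hx.
    apply (weighted_pointwise sigma alpha (INR n) kappa x a b c); try assumption; lra. }
  apply integ_le in Hpt; [| contI_solve | contI_solve].
  rewrite !integ_plus, !integ_scal in Hpt by contI_solve.
  fold (energy Vr Vi n) (energy Fr Fi n) (energy Vr Vi (pred n)) in Hpt.
  fold (energy2 Vr Vi n) in Hpt.
  assert (H1 : 0 <= h 1).
  { unfold h. apply Rplus_le_le_0_compat.
    - apply Rmult_le_pos; nra.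
    - apply Rmult_le_pos; [|nra]. apply Rmult_le_pos; [|lra].
      apply Rdiv_le_0_compat; nra. }
  assert (H0 : h 0 = 0) by (unfold h; ring).
  change (integ (fun x => dh x)) with (integ dh) in Hpt.
  lra.
Qed.

(** At x = 0 the diagonal coefficient is s + k with k = (n+1) kappa >= 0. Assuming the lower bound
    for every k >= 0 makes the estimate uniform in n and kappa. *)
Lemma trace0_step (sigma rho kappa a b : R) (N n : nat)
    (Vr Vi Fr Fi : nat -> R -> R) :
  0 < sigma -> sigma < rho -> (1 <= N <= n)%nat -> 0 <= kappa ->
  (forall k, 0 <= k -> rho ^ 2 <= (k + a) ^ 2 + b ^ 2) ->
  scaled_system sigma kappa a b N Vr Vi Fr Fi ->
  rho ^ 2 * trace0 Vr Vi n <=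
    (rho ^ 2 + sigma ^ 2) / 2 * (coefN N n * trace0 Vr Vi (pred n))
    + (1 + 2 * sigma ^ 2 / (rho ^ 2 - sigma ^ 2)) * trace0 Fr Fi n.
Proof.
  intros Hs Hr HN Hk Hab HS.
  assert (H0 : inI 0) by (unfold inI; lra).
  pose proof (ss_re _ _ _ _ _ _ _ _ _ HS n 0 (proj2 HN) H0) as Er.
  pose proof (ss_im _ _ _ _ _ _ _ _ _ HS n 0 (proj2 HN) H0) as Ei.
  pose proof (pos_INR n).
  apply (boundary_pointwise sigma rho ((INR n + 1) * kappa + a) b); try assumption.
  - apply coefN_bounds, HN.
  - apply Hab. nra.
  - rewrite <- Er. ring.
  - rewrite <- Ei. ring.
Qed.

(** * Partial sums and their limits *)

Lemma series_from_S (u : nat -> R) (N m : nat) :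
  series_from u N (S m) = series_from u N m + u (S (N + m)).
Proof. unfold series_from. simpl. rewrite Nat.add_succ_r. reflexivity. Qed.

Lemma series_from_0 (u : nat -> R) (N : nat) : series_from u N 0 = u N.
Proof. unfold series_from. simpl. rewrite Nat.add_0_r. reflexivity. Qed.

Lemma series_from_le (u v : nat -> R) (N m : nat) :
  (forall n, (N <= n)%nat -> u n <= v n) -> series_from u N m <= series_from v N m.
Proof. intros H. apply sum_Rle. intros k _. apply H. lia. Qed.

Lemma series_from_ge0 (u : nat -> R) (N m : nat) :
  (forall n, 0 <= u n) -> 0 <= series_from u N m.
Proof. intros H. apply cond_pos_sum. intros k. apply H. Qed.

Lemma series_from_plus (u v : nat -> R) (N m : nat) :
  series_from (fun n => u n + v n) N m = series_from u N m + series_from v N m.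
Proof. unfold series_from. apply (sum_plus (fun j => u (N + j)%nat) (fun j => v (N + j)%nat)). Qed.

Lemma series_from_scal (c : R) (u : nat -> R) (N m : nat) :
  series_from (fun n => c * u n) N m = c * series_from u N m.
Proof.
  induction m as [|m IH].
  - rewrite !series_from_0. reflexivity.
  - rewrite !series_from_S, IH. ring.
Qed.

Lemma series_from_telescope (g : nat -> R) (N m : nat) :
  series_from (fun n => g n - g (S n)) N m = g N - g (S (N + m)).
Proof.
  induction m as [|m IH].
  - rewrite series_from_0, Nat.add_0_r. reflexivity.
  - rewrite series_from_S, IH, Nat.add_succ_r. ring.
Qed.

(** The zero of [c] at [N] removes [g (pred N)], a quantity outside the range of the norms; the
    other terms are those of [g], shifted by one. *)
Lemma series_from_shift (c g : nat -> R) (N m : nat) :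
  c N = 0 -> (forall n, (N <= n)%nat -> c n <= 1) -> (forall n, 0 <= g n) ->
  series_from (fun n => c n * g (pred n)) N m <= series_from g N m.
Proof.
  intros Hc0 Hc Hg.
  (* The shifted sum misses the last term of [g]; keeping it on the left makes the induction go
     through. *)
  assert (H : series_from (fun n => c n * g (pred n)) N m + g (N + m)%nat
              <= series_from g N m).
  { induction m as [|m IH].
    - rewrite !series_from_0, Nat.add_0_r, Hc0. lra.
    - rewrite !series_from_S, Nat.add_succ_r. simpl pred.
      assert (c (S (N + m)) <= 1) by (apply Hc; lia).
      pose proof (Hg (N + m)%nat). nra. }
  pose proof (Hg (N + m)%nat). lra.
Qed.

Lemma Un_cv_le (u : nat -> R) (l B : R) :
  Un_cv u l -> (forall m, u m <= B) -> l <= B.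
Proof.
  intros H Hu. apply is_lim_seq_Reals in H.
  apply (is_lim_seq_le u (fun _ => B) l B Hu H), is_lim_seq_const.
Qed.

Lemma Un_cv_series_ge (u : nat -> R) (N m : nat) (l : R) :
  (forall n, 0 <= u n) -> Un_cv (series_from u N) l -> series_from u N m <= l.
Proof.
  intros Hu H. apply (sum_incr (fun j => u (N + j)%nat)); [exact H|].
  intros k. apply Hu.
Qed.

(** * Summation over the indices *)

Lemma energy_ge0 (V W : nat -> R -> R) (n : nat) :
  (forall n, contI (V n)) -> (forall n, contI (W n)) -> 0 <= energy V W n.
Proof. intros HV HW. apply integ_ge0; [contI_solve|]. intros x _. nra. Qed.

Lemma trace0_ge0 (V W : nat -> R -> R) (n : nat) : 0 <= trace0 V W n.
Proof. unfold trace0. nra. Qed.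

(** Crude bound for the end term of the telescoped sum. Although [cross_max] grows with T, its
    product with the cutoff is bounded because the cutoff vanishes beyond [T1], so the constant
    depends neither on n nor on kappa. *)
Lemma flux_lower (sigma L T0 T1 delta kappa eps : R) (N n : nat)
    (Vr Vi : nat -> R -> R) :
  0 < sigma -> 0 <= L -> T0 < T1 -> 0 < T1 -> 0 < delta -> 0 <= kappa ->
  eps ^ 2 = 1 -> (1 <= N <= S n)%nat ->
  (forall n, contI (Vr n)) -> (forall n, contI (Vi n)) ->
  - integ (flux sigma L T0 T1 delta kappa eps N Vr Vi (S n)) <=
    (sigma * L + L * cross_max sigma T1 + delta) * (energy Vr Vi n + energy Vr Vi (S n)).
Proof.
  intros Hs HL H01 HT1 Hd Hk Heps HN Cr Ci.
  set (C := sigma * L + L * cross_max sigma T1 + delta).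
  assert (Cf := flux_contI sigma L T0 T1 delta kappa eps N Vr Vi (S n) Cr Ci).
  unfold energy. rewrite <- integ_plus, <- integ_scal by contI_solve.
  replace (- integ (flux sigma L T0 T1 delta kappa eps N Vr Vi (S n)))
    with (-1 * integ (flux sigma L T0 T1 delta kappa eps N Vr Vi (S n))) by ring.
  rewrite <- integ_scal by exact Cf.
  apply integ_le; [contI_solve|contI_solve|].
  intros x Hx. unfold flux. simpl pred.
  set (T := (INR (S n) + 1) * (kappa + 2 * x)).
  assert (HT : 0 <= T).
  { destruct Hx. pose proof (pos_INR (S n)). unfold T. apply Rmult_le_pos; lra. }
  pose proof (cutoff_bounds L T0 T1 T HL) as [Hm0 HmL].
  pose proof (cross_max_pos sigma T Hs). pose proof (cross_max_pos sigma T1 Hs).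
  assert (Hmm : cutoff L T0 T1 T * cross_max sigma T <= L * cross_max sigma T1).
  { destruct (Rle_or_lt T1 T) as [Hc|Hc].
    - rewrite cutoff_vanish by assumption. nra.
    - apply Rmult_le_compat; try lra. apply cross_max_incr; lra. }
  pose proof (coefN_bounds N (S n) HN) as Hc.
  set (c := coefN N (S n)) in *. set (m := cutoff L T0 T1 T) in *.
  set (p := Vr (S n) x). set (q := Vi (S n) x). set (p0 := Vr n x). set (q0 := Vi n x).
  assert (HJ : Rabs (q * p0 - p * q0) <= (p0 ^ 2 + q0 ^ 2 + (p ^ 2 + q ^ 2)) / 2).
  { pose proof (pow2_ge_0 (q - p0)). pose proof (pow2_ge_0 (p + q0)).
    pose proof (pow2_ge_0 (q + p0)). pose proof (pow2_ge_0 (p - q0)).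
    apply Rabs_le. split; lra. }
  assert (Habse : Rabs eps = 1).
  { assert (Hq : Rabs eps ^ 2 = 1) by (rewrite pow2_abs; exact Heps).
    pose proof (Rabs_pos eps). nra. }
  set (S0 := p0 ^ 2 + q0 ^ 2) in *. set (S1 := p ^ 2 + q ^ 2) in *.
  assert (0 <= S0) by (unfold S0; nra). assert (0 <= S1) by (unfold S1; nra).
  assert (Hcm : 0 <= c * sigma * m <= sigma * L).
  { assert (0 <= c * sigma <= sigma) by nra. split; [nra|].
    apply Rmult_le_compat; lra. }
  assert (HP : - (eps * c * sigma * m * (q * p0 - p * q0)) <= sigma * L * (S0 + S1)).
  { eapply Rle_trans; [apply Rle_abs|].
    replace (- (eps * c * sigma * m * (q * p0 - p * q0)))
      with (- (eps * ((c * sigma * m) * (q * p0 - p * q0)))) by ring.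
    rewrite Rabs_Ropp, Rabs_mult, Habse, Rmult_1_l, Rabs_mult.
    apply Rmult_le_compat; try apply Rabs_pos.
    - rewrite Rabs_right; lra.
    - lra. }
  assert (HR : (m * cross_max sigma T / 2 + delta / 4) * S1 <= (L * cross_max sigma T1 + delta) * S1).
  { apply Rmult_le_compat_r; [assumption|]. assert (0 <= m * cross_max sigma T) by nra. lra. }
  assert (0 <= (L * cross_max sigma T1 + delta) * S0) by (apply Rmult_le_pos; nra).
  unfold C. lra.
Qed.

(** The three estimates are triangular: the traces close by themselves, the energies use the traces,
    and the weighted energies use the energies. [K] is fixed before [N], [kappa] and s, which gives
    the required uniformity. *)
Lemma scaled_estimate (sigma alpha beta rho L T0 T1 delta : R) :
  0 < sigma -> sigma < rho -> 0 <= L -> T0 < T1 -> 0 < T1 -> 0 < delta ->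
  exists K, 0 < K /\
  forall (N : nat) (kappa a b : R) (Vr Vi Fr Fi : nat -> R -> R)
         (SA SB SY SFA SFY : R),
    (1 <= N)%nat ->
    (forall n T, (N <= n)%nat -> 0 <= T ->
      2 * delta <= T - T / (2 * (INR n + 1)) - alpha
                   + cutoff L T0 T1 T * (beta - cross_max sigma T)) ->
    (forall n, (N <= n)%nat -> shift_err sigma L T0 T1 / (INR n + 1) <= delta / 2) ->
    0 <= kappa -> - alpha <= a -> beta <= Rabs b ->
    (forall k, 0 <= k -> rho ^ 2 <= (k + a) ^ 2 + b ^ 2) ->
    scaled_system sigma kappa a b N Vr Vi Fr Fi ->
    Un_cv (series_from (energy Vr Vi) N) SA ->
    Un_cv (series_from (energy2 Vr Vi) N) SB ->
    Un_cv (series_from (trace0 Vr Vi) N) SY ->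
    Un_cv (series_from (energy Fr Fi) N) SFA ->
    Un_cv (series_from (trace0 Fr Fi) N) SFY ->
    SA + SB + SY <= K * (SFA + SFY).
Proof.
  intros Hs Hr HL H01 HT1 Hd.
  set (C3 := 1 + 2 * sigma ^ 2 / (rho ^ 2 - sigma ^ 2)).
  assert (Hrs : 0 < rho ^ 2 - sigma ^ 2) by nra.
  assert (HC3 : 0 < C3).
  { unfold C3. assert (0 <= 2 * sigma ^ 2 / (rho ^ 2 - sigma ^ 2))
      by (apply Rdiv_le_0_compat; nra). lra. }
  (* The divisor is what remains of rho^2 after subtracting the midpoint (rho^2 + sigma^2)/2. *)
  set (K1 := C3 / ((rho ^ 2 - sigma ^ 2) / 2)).
  assert (HK1 : 0 < K1) by (apply Rdiv_lt_0_compat; lra).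
  set (K2 := ((1 + L ^ 2) / delta + sigma ^ 2 / 2 * K1) / delta).
  assert (HK2a : 0 < (1 + L ^ 2) / delta) by (apply Rdiv_lt_0_compat; nra).
  assert (HK2b : 0 < sigma ^ 2 / 2 * K1) by (apply Rmult_lt_0_compat; nra).
  assert (HK2 : 0 < K2) by (apply Rdiv_lt_0_compat; lra).
  set (K3 := (2 * alpha ^ 2 + sigma ^ 2 / 2) * K2 + 2).
  assert (HK3 : 0 < K3).
  { unfold K3. assert (0 <= (2 * alpha ^ 2 + sigma ^ 2 / 2) * K2)
      by (apply Rmult_le_pos; nra). lra. }
  exists (K1 + K2 + K3). split; [lra|].
  intros N kappa a b Vr Vi Fr Fi SA SB SY SFA SFY HN Hbr HE Hk Ha Hb Hab HS
    CA CB CY CFA CFY.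
  destruct (ss_contI _ _ _ _ _ _ _ _ _ HS) as [Cr Ci].
  pose proof (ss_cFr _ _ _ _ _ _ _ _ _ HS) as CFr.
  pose proof (ss_cFi _ _ _ _ _ _ _ _ _ HS) as CFi.
  pose proof (fun n => energy_ge0 Vr Vi n Cr Ci) as PA.
  pose proof (fun n => energy_ge0 Fr Fi n CFr CFi) as PFA.
  pose proof (trace0_ge0 Vr Vi) as PY. pose proof (trace0_ge0 Fr Fi) as PFY.
  pose proof (coefN_diag N HN) as Hc0.
  assert (Hc1 : forall n, (N <= n)%nat -> coefN N n <= 1)
    by (intros; apply coefN_bounds; lia).
  assert (QFA : forall m, 0 <= series_from (energy Fr Fi) N m <= SFA).
  { intros m. split; [apply series_from_ge0, PFA|apply Un_cv_series_ge; assumption]. }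
  assert (QFY : forall m, 0 <= series_from (trace0 Fr Fi) N m <= SFY).
  { intros m. split; [apply series_from_ge0, PFY|apply Un_cv_series_ge; assumption]. }
  assert (HSFA : 0 <= SFA) by (destruct (QFA O); lra).
  assert (HSFY : 0 <= SFY) by (destruct (QFY O); lra).
  assert (EY : forall m, series_from (trace0 Vr Vi) N m <= K1 * SFY).
  { intros m.
    assert (H : series_from (fun n => rho ^ 2 * trace0 Vr Vi n) N m <=
      series_from (fun n => (rho ^ 2 + sigma ^ 2) / 2 * (coefN N n * trace0 Vr Vi (pred n))
        + C3 * trace0 Fr Fi n) N m).
    { apply series_from_le. intros n Hn.
      apply trace0_step with (kappa := kappa) (a := a) (b := b); auto. }
    rewrite series_from_plus, !series_from_scal in H.
    pose proof (series_from_shift (coefN N) (trace0 Vr Vi) N m Hc0 Hc1 PY) as Hsh.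
    apply (Rmult_le_compat_l ((rho ^ 2 + sigma ^ 2) / 2)) in Hsh; [|nra].
    apply Rmult_le_reg_l with ((rho ^ 2 - sigma ^ 2) / 2); [lra|].
    replace ((rho ^ 2 - sigma ^ 2) / 2 * (K1 * SFY)) with (C3 * SFY)
      by (unfold K1; field; lra).
    assert (C3 * series_from (trace0 Fr Fi) N m <= C3 * SFY)
      by (apply Rmult_le_compat_l; [lra|apply QFY]).
    lra. }
  assert (HSY : SY <= K1 * SFY) by (apply (Un_cv_le _ _ _ CY EY)).
  (* [eps] is the sign of Im s, which orients the imaginary part of the equation. *)
  assert (exists eps, eps ^ 2 = 1 /\ beta <= eps * b) as [eps [Heps Hbe]].
  { destruct (Rle_or_lt 0 b) as [Hb0|Hb0].
    - exists 1. split; [ring|]. rewrite Rabs_right in Hb; lra.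
    - exists (-1). split; [ring|]. rewrite Rabs_left in Hb; lra. }
  set (fl := fun n => integ (flux sigma L T0 T1 delta kappa eps N Vr Vi n)).
  set (C4 := sigma * L + L * cross_max sigma T1 + delta).
  assert (EA : forall m, delta * series_from (energy Vr Vi) N m <=
    delta * (K2 * (SFA + SFY)) + C4 * (energy Vr Vi (N + m) + energy Vr Vi (S (N + m)))).
  { intros m.
    assert (H : series_from (fun n => delta * energy Vr Vi n) N m <=
      series_from (fun n => ((1 + L ^ 2) / delta * energy Fr Fi n
        + sigma ^ 2 / 2 * (coefN N n * trace0 Vr Vi (pred n))) + (fl n - fl (S n))) N m).
    { apply series_from_le. intros n Hn.
      pose proof (energy_step sigma L T0 T1 alpha beta delta kappa a b eps N n Vr Vi Fr Fi
        Hs HL H01 HT1 Hd (conj HN Hn) Hk Heps Ha Hbe HS (fun T => Hbr n T Hn) (HE n Hn)).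
      unfold fl. lra. }
    rewrite !series_from_plus, !series_from_scal, series_from_telescope in H.
    assert (H1 : - fl (S (N + m))
      <= C4 * (energy Vr Vi (N + m) + energy Vr Vi (S (N + m))))
      by (apply flux_lower; auto; lia).
    (* At n = N the cross term carries the factor [coefN N N], which is zero, and the rest of the
       flux is nonpositive. *)
    assert (H2 : fl N <= 0).
    { assert (0 <= -1 * fl N); [|lra]. unfold fl. rewrite <- integ_scal
        by (apply flux_contI; assumption).
      apply integ_ge0; [apply (contI_mult (fun _ => -1)); [apply contI_const|apply flux_contI; assumption]|].
      intros x Hx. unfold flux. rewrite Hc0.
      set (T := (INR N + 1) * (kappa + 2 * x)).
      pose proof (cutoff_bounds L T0 T1 T HL) as [Hm0 _]. pose proof (cross_max_pos sigma T Hs).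
      assert (0 <= (cutoff L T0 T1 T * cross_max sigma T / 2 + delta / 4) * (Vr N x ^ 2 + Vi N x ^ 2))
        by (apply Rmult_le_pos; nra).
      lra. }
    pose proof (series_from_shift (coefN N) (trace0 Vr Vi) N m Hc0 Hc1 PY) as Hsh.
    pose proof (Rle_trans _ _ _ Hsh (EY m)) as Hsh'.
    apply (Rmult_le_compat_l (sigma ^ 2 / 2)) in Hsh'; [|nra].
    assert ((1 + L ^ 2) / delta * series_from (energy Fr Fi) N m <= (1 + L ^ 2) / delta * SFA)
      by (apply Rmult_le_compat_l; [lra|apply QFA]).
    replace (delta * (K2 * (SFA + SFY)))
      with ((1 + L ^ 2) / delta * SFA + sigma ^ 2 / 2 * (K1 * SFY)
            + ((1 + L ^ 2) / delta * SFY + sigma ^ 2 / 2 * K1 * SFA))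
      by (unfold K2; field; lra).
    assert (0 <= (1 + L ^ 2) / delta * SFY) by (apply Rmult_le_pos; lra).
    assert (0 <= sigma ^ 2 / 2 * K1 * SFA) by (apply Rmult_le_pos; lra).
    lra. }
  assert (HSA : SA <= K2 * (SFA + SFY)).
  { apply Rmult_le_reg_l with delta; [exact Hd|].
    pose proof (proj2 (is_lim_seq_Reals _ _) CA) as LA.
    pose proof (proj1 (is_lim_seq_incr_1 _ _) LA) as LA1.
    pose proof (proj1 (is_lim_seq_incr_1 _ _) LA1) as LA2.
    set (s := series_from (energy Vr Vi) N) in *.
    set (B := delta * (K2 * (SFA + SFY))) in *.
    (* The two consecutive energies form a difference of partial sums of a convergent series; in the
       limit they disappear together with [C4]. *)
    assert (Hle : forall k, delta * s (S k) <= B + C4 * (s (S (S k)) - s k)).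
    { intros k. pose proof (EA (S k)) as H. fold s in H.
      replace (s (S (S k)) - s k)
        with (energy Vr Vi (N + S k) + energy Vr Vi (S (N + S k))); [exact H|].
      unfold s. rewrite !series_from_S, Nat.add_succ_r. ring. }
    assert (L1 : is_lim_seq (fun k => delta * s (S k)) (delta * SA))
      by (apply (is_lim_seq_scal_l (fun k => s (S k)) delta SA), LA1).
    assert (L2 : is_lim_seq (fun k => B + C4 * (s (S (S k)) - s k)) (B + C4 * (SA - SA))).
    { apply is_lim_seq_plus'; [apply is_lim_seq_const|].
      apply (is_lim_seq_scal_l (fun k => s (S (S k)) - s k) C4 (SA - SA)).
      apply is_lim_seq_minus'; [exact LA2|exact LA]. }
    pose proof (is_lim_seq_le _ _ _ _ Hle L1 L2) as H. simpl in H. lra. }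
  assert (HSB : SB <= K3 * (SFA + SFY)).
  { apply (Un_cv_le _ _ _ CB). intros m.
    assert (H : series_from (energy2 Vr Vi) N m <=
      series_from (fun n => 2 * alpha ^ 2 * energy Vr Vi n + 2 * energy Fr Fi n
        + sigma ^ 2 / 2 * (coefN N n * energy Vr Vi (pred n))) N m).
    { apply series_from_le. intros n Hn.
      apply energy2_step with (kappa := kappa) (a := a) (b := b); auto. }
    rewrite !series_from_plus, !series_from_scal in H.
    pose proof (series_from_shift (coefN N) (energy Vr Vi) N m Hc0 Hc1 PA) as Hsh.
    assert (HA : series_from (energy Vr Vi) N m <= SA) by (apply Un_cv_series_ge; assumption).
    assert (HA' : series_from (energy Vr Vi) N m <= K2 * (SFA + SFY)) by lra.
    pose proof (Rle_trans _ _ _ Hsh HA') as Hsh'.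
    apply (Rmult_le_compat_l (sigma ^ 2 / 2)) in Hsh'; [|nra].
    apply (Rmult_le_compat_l (2 * alpha ^ 2)) in HA'; [|nra].
    destruct (QFA m). unfold K3. lra. }
  assert (K1 * SFY <= K1 * (SFA + SFY)) by (apply Rmult_le_compat_l; lra).
  lra.
Qed.

(** * From the geometry of the region to local parameters *)

Lemma cabs_ge0 (a b : R) : 0 <= cabs a b.
Proof. apply sqrt_pos. Qed.

Lemma cabs_sqr (a b : R) : cabs a b ^ 2 = a ^ 2 + b ^ 2.
Proof. apply pow2_sqrt. nra. Qed.

Lemma cabs_ge_snd (a b : R) : Rabs b <= cabs a b.
Proof.
  apply Rsqr_incr_0_var; [|apply cabs_ge0].
  rewrite !Rsqr_pow2, pow2_abs, cabs_sqr. nra.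
Qed.

Lemma Omega_dichotomy (sigma a b : R) : 0 < sigma -> Omega sigma a b ->
  (0 < a /\ sigma ^ 2 < a ^ 2 + b ^ 2) \/
  (a <= 0 /\ sigma < Rabs b /\ a ^ 2 < 4 * sigma * Rabs b).
Proof.
  intros Hs [[[Ha Hb]|[Ha Hb]] H23].
  2:{ left. split; [exact Ha|]. rewrite <- cabs_sqr. nra. }
  right. split; [exact Ha|]. split; [exact Hb|].
  pose proof (cabs_ge_snd a b) as Hrb. pose proof (cabs_sqr a b) as Hr2.
  rewrite <- (pow2_abs b) in Hr2.
  unfold Omega2, Omega3 in H23.
  set (r := cabs a b) in *. set (y := Rabs b) in *.
  assert (Hr : 0 < r) by lra.
  assert (Hra : - a <= r) by nra.
  destruct H23 as [[H1 H2]|[_ H3]].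
  (* In the second region: (r + a)^2 <= (r + a)(r - a) = b^2 because a <= 0, and a^2 <= - a r, so
     even a^2 < 2 sigma |b|. *)
  - assert (H4 : - a * r < 2 * sigma * (r + a)).
    { apply Rmult_gt_compat_r with (r := 2 * (r + a)) in H2; [|lra].
      unfold Rdiv in H2. rewrite Rmult_assoc, Rinv_l in H2 by lra. lra. }
    assert (H5 : r + a <= y).
    { assert (0 <= - a * (r + a)) by nra.
      apply Rsqr_incr_0_var; [|apply Rabs_pos]. rewrite !Rsqr_pow2. nra. }
    assert (sigma * (r + a) <= sigma * y) by (apply Rmult_le_compat_l; lra).
    assert (0 <= sigma * y) by (apply Rmult_le_pos; lra).
    assert (a ^ 2 <= - a * r) by nra. lra.
  (* In the third region: after expanding the square, the terms sigma a cancel and a^2/4 < sigma (r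
     - a^2/r) is left, where r - a^2/r = b^2/r <= |b|. *)
  - set (c := a / r) in *.
    assert (Hc : a = c * r) by (unfold c; field; lra).
    assert (H5 : (sigma * (1 + c) + a / 2) ^ 2
      = sigma ^ 2 * (1 + c) ^ 2 + sigma * (a + c * a) + a ^ 2 / 4) by field.
    assert (H6 : a ^ 2 / 4 < sigma * (r - c * a)).
    { rewrite H5 in H3. pose proof (pow2_ge_0 (sigma * (1 + c))) as H7.
      rewrite Rpow_mult_distr in H7. nra. }
    assert (H8 : (r - c * a) * r = y ^ 2).
    { replace ((r - c * a) * r) with (r ^ 2 - a * (c * r)) by ring.
      rewrite <- Hc, Hr2. ring. }
    assert (H9 : r - c * a <= y).
    { apply Rmult_le_reg_r with r; [exact Hr|]. rewrite H8. nra. }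
    assert (sigma * (r - c * a) <= sigma * y) by (apply Rmult_le_compat_l; lra).
    lra.
Qed.

(* Local parameters: Re s >= - alpha, |Im s| >= beta, and |s + k| >= rho for k >= 0. *)
Definition admissible (sigma alpha beta rho L T0 T1 delta : R) (N : nat) : Prop :=
  sigma < rho /\ 0 <= L /\ T0 < T1 /\ 0 < T1 /\ 0 < delta /\ (1 <= N)%nat /\
  (forall n T, (N <= n)%nat -> 0 <= T ->
     2 * delta <= T - T / (2 * (INR n + 1)) - alpha
                  + cutoff L T0 T1 T * (beta - cross_max sigma T)) /\
  (forall n, (N <= n)%nat -> shift_err sigma L T0 T1 / (INR n + 1) <= delta / 2).

(** For Re s > 0 the real part suffices, so [L = 0] switches the cutoff off and [beta], [T0], [T1]
    are placeholders. The margin comes from Re s >= a0/2, and rho^2 is the midpoint of sigma^2 and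
    |s0|^2. *)
Lemma admissible_right (sigma a0 b0 : R) :
  0 < sigma -> 0 < a0 -> sigma ^ 2 < a0 ^ 2 + b0 ^ 2 ->
  exists alpha beta rho L T0 T1 delta N d,
    admissible sigma alpha beta rho L T0 T1 delta N /\ 0 < d /\
    forall a b, Rabs (a - a0) < d -> Rabs (b - b0) < d ->
      - alpha <= a /\ beta <= Rabs b /\
      forall k, 0 <= k -> rho ^ 2 <= (k + a) ^ 2 + b ^ 2.
Proof.
  intros Hs Ha Hr.
  set (R2 := (sigma ^ 2 + (a0 ^ 2 + b0 ^ 2)) / 2).
  assert (HR2 : sigma ^ 2 < R2) by (unfold R2; lra).
  (* Small enough that moving both coordinates by less than [e] lowers |s|^2 by less than half of
     its gap to sigma^2. *)
  set (e := (a0 ^ 2 + b0 ^ 2 - sigma ^ 2) / (4 * (Rabs a0 + Rabs b0 + 1))).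
  pose proof (Rabs_pos a0) as Pa. pose proof (Rabs_pos b0) as Pb.
  assert (He : 0 < e) by (apply Rdiv_lt_0_compat; lra).
  exists (- (a0 / 2)), 0, (sqrt R2), 0, 0, 1, (a0 / 4), 1%nat, (Rmin e (a0 / 2)).
  assert (Hq : sqrt R2 ^ 2 = R2) by (apply pow2_sqrt; nra).
  split; [|split].
  - repeat split; try lra; try lia.
    + rewrite <- (sqrt_pow2 sigma) by lra. apply sqrt_lt_1; nra.
    + intros n T _ HT. unfold cutoff. pose proof (pos_INR n).
      assert (T / (2 * (INR n + 1)) <= T).
      { apply Rmult_le_reg_r with (2 * (INR n + 1)); [lra|].
        unfold Rdiv. rewrite Rmult_assoc, Rinv_l by lra. nra. }
      lra.
    + intros n _. unfold shift_err, Rdiv. rewrite !Rmult_0_l, Rplus_0_l, Rmult_0_l. lra.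
  - apply Rmin_glb_lt; lra.
  - intros a b Hda Hdb.
    assert (Ha1 := Rlt_le_trans _ _ _ Hda (Rmin_l _ _)).
    assert (Ha2 := Rlt_le_trans _ _ _ Hda (Rmin_r _ _)).
    assert (Hb1 := Rlt_le_trans _ _ _ Hdb (Rmin_l _ _)).
    apply Rabs_def2 in Ha2.
    split; [lra|]. split; [apply Rabs_pos|].
    intros k Hk. rewrite Hq.
    assert (Hee : e * (4 * (Rabs a0 + Rabs b0 + 1)) = a0 ^ 2 + b0 ^ 2 - sigma ^ 2)
      by (unfold e; field; lra).
    assert (Hsq : forall y y0, Rabs (y - y0) < e -> y0 ^ 2 - 2 * (e * Rabs y0) <= y ^ 2).
    { intros y y0 Hy. assert (Habs : Rabs ((y - y0) * y0) <= e * Rabs y0).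
      { rewrite Rabs_mult. apply Rmult_le_compat_r; [apply Rabs_pos|lra]. }
      pose proof (Rle_abs (- ((y - y0) * y0))) as H. rewrite Rabs_Ropp in H.
      pose proof (pow2_ge_0 (y - y0)). lra. }
    pose proof (Hsq a a0 Ha1). pose proof (Hsq b b0 Hb1).
    assert (a ^ 2 <= (k + a) ^ 2) by nra.
    unfold R2. lra.
Qed.

(** [T1] = 2 sqrt(sigma beta) is the point where [cross_max] reaches [beta]. The interval from - a0
    to [T1] is cut into thirds of length [eta], giving - a0 < [alpha] < [T0] < [T1]. As |Im s| >=
    beta > sigma, [rho] = [beta] works for every shift k. *)
Lemma admissible_left (sigma a0 b0 : R) :
  0 < sigma -> a0 <= 0 -> sigma < Rabs b0 -> a0 ^ 2 < 4 * sigma * Rabs b0 ->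
  exists alpha beta rho L T0 T1 delta N d,
    admissible sigma alpha beta rho L T0 T1 delta N /\ 0 < d /\
    forall a b, Rabs (a - a0) < d -> Rabs (b - b0) < d ->
      - alpha <= a /\ beta <= Rabs b /\
      forall k, 0 <= k -> rho ^ 2 <= (k + a) ^ 2 + b ^ 2.
Proof.
  intros Hs Ha Hb Hab.
  set (b1 := Rmax sigma (a0 ^ 2 / (4 * sigma))).
  assert (Hdiv : forall t y, t < 4 * sigma * y <-> t / (4 * sigma) < y).
  { intros t y. split; intros H.
    - apply Rmult_lt_reg_r with (4 * sigma); [lra|].
      unfold Rdiv. rewrite Rmult_assoc, Rinv_l by lra. lra.
    - apply Rmult_lt_compat_r with (r := 4 * sigma) in H; [|lra].
      unfold Rdiv in H. rewrite Rmult_assoc, Rinv_l in H by lra. lra. }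
  assert (Hb1 : b1 < Rabs b0) by (apply Rmax_lub_lt; [exact Hb|apply Hdiv, Hab]).
  set (beta := (b1 + Rabs b0) / 2).
  assert (Hbs : sigma < beta).
  { assert (sigma <= b1) by apply Rmax_l. unfold beta. lra. }
  assert (Hba : a0 ^ 2 < 4 * sigma * beta).
  { apply Hdiv. assert (a0 ^ 2 / (4 * sigma) <= b1) by apply Rmax_r. unfold beta. lra. }
  assert (Hbb : beta < Rabs b0) by (unfold beta; lra).
  set (T1 := sqrt (4 * sigma * beta)).
  assert (HT1s : T1 ^ 2 = 4 * sigma * beta) by (apply pow2_sqrt; nra).
  assert (HT1p : 0 <= T1) by apply sqrt_pos.
  assert (HT1a : - a0 < T1) by nra.
  set (eta := (T1 + a0) / 3).
  assert (Heta : 0 < eta) by (unfold eta; lra).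
  set (T0 := - a0 + 2 * eta).
  assert (HT0 : 0 < T0) by (unfold T0; lra).
  assert (H01 : T0 < T1) by (unfold T0, eta; lra).
  set (alpha := - a0 + eta).
  assert (Hmm0 : cross_max sigma T0 < beta).
  { apply Rmax_lub_lt; [|exact Hbs]. apply Hdiv. rewrite <- HT1s. nra. }
  assert (Hmm1 : cross_max sigma T1 = beta).
  { unfold cross_max. rewrite HT1s. replace (4 * sigma * beta / (4 * sigma)) with beta
      by (field; lra). apply Rmax_left. lra. }
  (* Chosen so that at [T0] the imaginary part compensates [- alpha] and leaves eta/2 = 2 delta. *)
  set (L := (eta / 2 + alpha) / (beta - cross_max sigma T0)).
  assert (HL : 0 < L) by (apply Rdiv_lt_0_compat; unfold alpha; lra).
  set (E := shift_err sigma L T0 T1).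
  assert (HE : 0 <= E).
  { unfold E, shift_err. apply Rplus_le_le_0_compat.
    - apply Rmult_le_pos; [lra|]. apply Rdiv_le_0_compat; [apply pow2_ge_0|lra].
    - apply Rmult_le_pos; [|rewrite Hmm1; lra]. apply Rmult_le_pos; [|lra].
      apply Rdiv_le_0_compat; lra. }
  assert (Hq1 : 0 <= T0 / eta) by (apply Rdiv_le_0_compat; lra).
  assert (Hq2 : 0 <= 8 * E / eta) by (apply Rdiv_le_0_compat; lra).
  destruct (INR_unbounded (T0 / eta + 8 * E / eta + 1)) as [N HN].
  assert (HNn : forall n, (N <= n)%nat ->
    T0 / (2 * (INR n + 1)) <= eta / 2 /\ E / (INR n + 1) <= eta / 8).
  { intros n Hn. apply le_INR in Hn.
    assert (Hdm : forall t c, 0 < c -> t / c <= INR n + 1 -> t / (INR n + 1) <= c).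
    { intros t c Hc Ht. apply Rmult_le_reg_r with (INR n + 1); [lra|].
      unfold Rdiv at 1. rewrite Rmult_assoc, Rinv_l, Rmult_1_r by lra.
      apply Rmult_le_compat_r with (r := c) in Ht; [|lra].
      unfold Rdiv in Ht. rewrite Rmult_assoc, Rinv_l, Rmult_1_r in Ht by lra. lra. }
    split.
    - replace (T0 / (2 * (INR n + 1))) with (T0 / (INR n + 1) / 2) by (field; lra).
      assert (T0 / (INR n + 1) <= eta) by (apply Hdm; lra). lra.
    - apply Hdm; [lra|]. replace (E / (eta / 8)) with (8 * E / eta) by (field; lra). lra. }
  exists alpha, beta, beta, L, T0, T1, (eta / 4), N, (Rmin eta (Rabs b0 - beta)).
  split; [|split].
  - assert (HN1 : (1 <= N)%nat) by (apply INR_le; simpl; lra).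
    repeat split; try lra; try assumption.
    + intros n T Hn HT. destruct (HNn n Hn) as [Hn1 _].
      assert (Hnp : 0 < 2 * (INR n + 1)) by (pose proof (pos_INR n); lra).
      assert (Hdc : forall t, t / (2 * (INR n + 1)) = t * / (2 * (INR n + 1))) by reflexivity.
      assert (Hinv : 0 < / (2 * (INR n + 1)) <= 1).
      { split; [apply Rinv_0_lt_compat; lra|].
        rewrite <- Rinv_1. apply Rinv_le_contravar; [lra|]. pose proof (pos_INR n); lra. }
      rewrite Hdc in *. set (i := / (2 * (INR n + 1))) in *.
      (* Up to [T0] the imaginary part gives the margin; beyond it the real part does, while the
         cutoff contribution is nonnegative below [T1] and zero from there on. *)
      destruct (Rle_or_lt T T0) as [HTa|HTa].
      * rewrite cutoff_top by assumption.
        pose proof (cross_max_incr sigma T T0 Hs HT HTa) as Hmi.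
        assert (L * (beta - cross_max sigma T0) <= L * (beta - cross_max sigma T))
          by (apply Rmult_le_compat_l; lra).
        assert (L * (beta - cross_max sigma T0) = eta / 2 + alpha) by (unfold L; field; lra).
        assert (T * i <= T) by nra. lra.
      * assert (Hlow : eta / 2 <= T - T * i - alpha).
        { assert (T0 - T0 * i <= T - T * i) by nra. unfold alpha, T0 in *. lra. }
        destruct (Rle_or_lt T1 T) as [HTb|HTb].
        { rewrite cutoff_vanish by assumption. lra. }
        pose proof (cross_max_incr sigma T T1 Hs HT (Rlt_le _ _ HTb)) as Hmi. rewrite Hmm1 in Hmi.
        pose proof (cutoff_bounds L T0 T1 T (Rlt_le _ _ HL)) as [Hm0 _].
        assert (0 <= cutoff L T0 T1 T * (beta - cross_max sigma T)) by (apply Rmult_le_pos; lra).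
        lra.
    + intros n Hn. destruct (HNn n Hn) as [_ H]. fold E. lra.
  - apply Rmin_glb_lt; lra.
  - intros a b Hda Hdb.
    assert (Ha2 := Rlt_le_trans _ _ _ Hda (Rmin_l _ _)).
    assert (Hb2 := Rlt_le_trans _ _ _ Hdb (Rmin_r _ _)).
    apply Rabs_def2 in Ha2.
    assert (Hbeta : beta <= Rabs b).
    { pose proof (Rabs_triang_inv b0 b). rewrite Rabs_minus_sym in Hb2. lra. }
    split; [unfold alpha; lra|]. split; [exact Hbeta|].
    intros k _. rewrite <- (pow2_abs b). pose proof (pow2_ge_0 (k + a)). nra.
Qed.

(** * Rescaling and translation of the norms *)

Definition scal_wt (sigma : R) (n : nat) : R :=
  sigma ^ n / (INR (fact n) * INR (fact (S n))).

Definition rescale (sigma : R) (D : nat -> R -> R) (n : nat) (x : R) : R :=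
  scal_wt sigma n * D n x.

Lemma scal_wt_S (sigma : R) (n : nat) : sigma <> 0 ->
  scal_wt sigma n = (INR n + 1) * (INR n + 1 + 1) / sigma * scal_wt sigma (S n).
Proof.
  intros Hs. unfold scal_wt. rewrite (fact_simpl (S n)), (fact_simpl n), !mult_INR, !S_INR.
  pose proof (INR_fact_neq_0 n). pose proof (pos_INR n). simpl pow. field. repeat split; lra.
Qed.

Lemma wt_scal_wt (sigma : R) (n : nat) : wt sigma n = scal_wt sigma n ^ 2.
Proof.
  unfold wt, scal_wt. rewrite Nat.mul_comm, pow_mult.
  pose proof (INR_fact_neq_0 n). pose proof (INR_fact_neq_0 (S n)). field. auto.
Qed.

Lemma smooth_contI (D : nat -> R -> R) (n : nat) : smooth_seq D -> contI (D n).
Proof. intros H. exact (contI_deriv _ _ (H n)). Qed.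

Lemma rescale_deriv (sigma : R) (D : nat -> R -> R) (n : nat) (x : R) :
  sigma <> 0 -> smooth_seq D -> inI x ->
  deriv_within (rescale sigma (dshift D) n) x
    ((INR n + 1) * (INR n + 1 + 1) / sigma * rescale sigma (dshift D) (S n) x).
Proof.
  intros Hs HD Hx.
  replace ((INR n + 1) * (INR n + 1 + 1) / sigma * rescale sigma (dshift D) (S n) x)
    with (scal_wt sigma n * D (S (S n)) x)
    by (unfold rescale, dshift; rewrite (scal_wt_S sigma n Hs); ring).
  apply deriv_within_scal, HD, Hx.
Qed.

Lemma rescale_ode (sigma : R) (N : nat) (lambda kappa a b : R)
    (D E G : nat -> R -> R) :
  sigma <> 0 -> (1 <= N)%nat -> smooth_seq D -> smooth_seq E -> smooth_seq G ->
  (forall x, inI x ->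
     (kappa + 2 * x) * D 1%nat x + (kappa * x + x ^ 2) * D 2%nat x
     + (a * D 1%nat x - b * E 1%nat x)
     - INR N * (INR N + 1) * D 0%nat x
     + lambda * sumR N (fun i => (x - 1) ^ i / INR (fact i) * D (S i) 1)
     = G 0%nat x) ->
  forall n x, (N <= n)%nat -> inI x ->
    (INR n + 1) * (INR n + 1 + 1) / sigma * (kappa * x + x ^ 2)
      * rescale sigma (dshift D) (S n) x
    + (INR n + 1) * (kappa + 2 * x) * rescale sigma (dshift D) n x
    + (a * rescale sigma (dshift D) n x - b * rescale sigma (dshift E) n x)
    + coefN N n * sigma * rescale sigma (dshift D) (pred n) x
    = rescale sigma G n x.
Proof.
  intros Hs HN HD HE HG H n x Hn Hx.
  pose proof (ode_derivatives N lambda kappa a b D E G HD HE HG H n x Hx) as Ho.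
  replace (N - n)%nat with O in Ho by lia. simpl sumR in Ho.
  unfold rescale, dshift. rewrite <- Ho.
  destruct n as [|k]; [lia|]. simpl pred.
  rewrite (scal_wt_S sigma k Hs), (scal_wt_S sigma (S k) Hs). unfold coefN.
  rewrite S_INR. pose proof (pos_INR k). field. repeat split; lra.
Qed.

Lemma term_k_energy (sigma : R) (D E : nat -> R -> R) (n : nat) :
  (forall n, contI (D n)) -> (forall n, contI (E n)) ->
  term_k sigma 0 D E n = energy (rescale sigma D) (rescale sigma E) n.
Proof.
  intros CD CE. unfold term_k, energy, rescale. rewrite wt_scal_wt.
  rewrite integral01_integ by (simpl pow; contI_solve).
  simpl (INR n ^ 0). rewrite Rmult_1_r, <- integ_scal by (simpl pow; contI_solve).
  apply integ_ext. intros x _. simpl. ring.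
Qed.

Lemma term_k_energy2 (sigma : R) (D E : nat -> R -> R) (n : nat) :
  sigma <> 0 -> (forall n, contI (D n)) -> (forall n, contI (E n)) ->
  term_k sigma 2 D E n
  = / sigma ^ 2 * energy2 (rescale sigma D) (rescale sigma E) n.
Proof.
  intros Hs CD CE. unfold term_k, energy2, rescale. rewrite wt_scal_wt.
  rewrite integral01_integ by (unfold Rdiv; contI_solve).
  rewrite <- Rmult_assoc, <- !integ_scal by (unfold Rdiv; contI_solve).
  apply integ_ext. intros x _. field. exact Hs.
Qed.

Lemma term_k_ge0 (sigma : R) (k : nat) (D E : nat -> R -> R) (n : nat) :
  0 < sigma -> (forall n, contI (D n)) -> (forall n, contI (E n)) ->
  0 <= term_k sigma k D E n.
Proof.
  intros Hs CD CE. unfold term_k. rewrite wt_scal_wt.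
  rewrite integral01_integ by (unfold Rdiv; contI_solve).
  apply Rmult_le_pos.
  - apply Rmult_le_pos; [apply pow2_ge_0|apply pow_le, pos_INR].
  - apply integ_ge0; [unfold Rdiv; contI_solve|]. intros x [Hx _].
    apply Rmult_le_pos; [|nra]. apply pow_le, Rdiv_le_0_compat; lra.
Qed.

(** With y = n x / sigma the weights for k = 0, 1, 2 are 1, y, y^2, and y <= 1 + y^2. The middle
    norm therefore needs no multiplier of its own. *)
Lemma term_k_interpolate (sigma : R) (D E : nat -> R -> R) (n : nat) :
  0 < sigma -> (forall n, contI (D n)) -> (forall n, contI (E n)) ->
  term_k sigma 1 D E n <= term_k sigma 0 D E n + term_k sigma 2 D E n.
Proof.
  intros Hs CD CE. unfold term_k.
  rewrite !integral01_integ by (unfold Rdiv; contI_solve).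
  rewrite <- !integ_scal, <- integ_plus by (unfold Rdiv; contI_solve).
  apply integ_le; [unfold Rdiv; contI_solve|unfold Rdiv; contI_solve|].
  intros x _. set (S := D n x ^ 2 + E n x ^ 2).
  assert (HS : 0 <= wt sigma n * S).
  { rewrite wt_scal_wt. apply Rmult_le_pos; [apply pow2_ge_0|unfold S; nra]. }
  set (y := INR n * (x / sigma)).
  replace (wt sigma n * INR n ^ 1 * ((x / sigma) ^ 1 * S)) with (y * (wt sigma n * S))
    by (unfold y; ring).
  replace (wt sigma n * INR n ^ 0 * ((x / sigma) ^ 0 * S)
           + wt sigma n * INR n ^ 2 * ((x / sigma) ^ 2 * S))
    with ((1 + y ^ 2) * (wt sigma n * S)) by (unfold y; ring).
  apply Rmult_le_compat_r; [exact HS|]. nra.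
Qed.

Lemma term_b_trace0 (sigma : R) (D E : nat -> R -> R) (n : nat) :
  term_b sigma D E n = sigma * trace0 (rescale sigma D) (rescale sigma E) n.
Proof. unfold term_b, trace0, rescale. rewrite wt_scal_wt. ring. Qed.

Lemma series_value_spec (u : nat -> R) (N : nat) :
  series_finite u N -> Un_cv (series_from u N) (series_value u N).
Proof. intros H. apply (epsilon_spec (inhabits 0) (fun l => Un_cv (series_from u N) l) H). Qed.

Lemma Un_cv_series_scal (c : R) (u v : nat -> R) (N : nat) (l : R) :
  (forall n, v n = c * u n) ->
  Un_cv (series_from u N) l -> Un_cv (series_from v N) (c * l).
Proof.
  intros Hv H. apply is_lim_seq_Reals.
  apply is_lim_seq_ext with (fun m => c * series_from u N m).
  - intros m. rewrite <- series_from_scal. apply sum_eq. intros. symmetry. apply Hv.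
  - apply (is_lim_seq_scal_l _ c l), is_lim_seq_Reals, H.
Qed.

Lemma sqrt_sum_bound (K S x y z : R) :
  0 <= K -> 0 <= x -> 0 <= y -> 0 <= z -> S <= K * (x + z) ->
  sqrt S <= sqrt K * (sqrt x + sqrt y + sqrt z).
Proof.
  intros HK Hx Hy Hz H.
  pose proof (sqrt_pos x). pose proof (sqrt_pos y). pose proof (sqrt_pos z).
  rewrite <- (sqrt_pow2 (sqrt x + sqrt y + sqrt z)) by lra.
  rewrite <- sqrt_mult_alt by exact HK.
  apply sqrt_le_1_alt. eapply Rle_trans; [exact H|].
  apply Rmult_le_compat_l; [exact HK|].
  pose proof (pow2_sqrt x Hx) as Ex. pose proof (pow2_sqrt z Hz) as Ez.
  set (p := sqrt x) in *. set (q := sqrt y) in *. set (r := sqrt z) in *.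
  assert (0 <= p * q) by (apply Rmult_le_pos; assumption).
  assert (0 <= p * r) by (apply Rmult_le_pos; assumption).
  assert (0 <= q * r) by (apply Rmult_le_pos; assumption).
  pose proof (pow2_ge_0 q). lra.
Qed.

(** * The estimate near one point of the region *)

(** [M] is both the threshold for [N] and the constant, so the property is monotone in one parameter
    and local versions merge by taking a larger [M]. *)
Definition estimate_at (sigma M a b : R) : Prop :=
  forall (N : nat) (lambda kappa : R) (Dur Dui Dfr Dfi : nat -> R -> R),
    M <= INR N -> 0 <= kappa ->
    smooth_seq Dur -> smooth_seq Dui -> smooth_seq Dfr -> smooth_seq Dfi ->
    (forall x, inI x ->
       (kappa + 2 * x) * Dur 1%nat x + (kappa * x + x ^ 2) * Dur 2%nat x
       + (a * Dur 1%nat x - b * Dui 1%nat x)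
       - INR N * (INR N + 1) * Dur 0%nat x
       + lambda * sumR N (fun i => (x - 1) ^ i / INR (fact i) * Dur (S i) 1)
       = Dfr 0%nat x) ->
    (forall x, inI x ->
       (kappa + 2 * x) * Dui 1%nat x + (kappa * x + x ^ 2) * Dui 2%nat x
       + (a * Dui 1%nat x + b * Dur 1%nat x)
       - INR N * (INR N + 1) * Dui 0%nat x
       + lambda * sumR N (fun i => (x - 1) ^ i / INR (fact i) * Dui (S i) 1)
       = Dfi 0%nat x) ->
    normk_finite sigma 0 N Dfr Dfi -> normk_finite sigma 1 N Dfr Dfi ->
    normb_finite sigma N Dfr Dfi ->
    normk_finite sigma 0 N (dshift Dur) (dshift Dui) ->
    normk_finite sigma 1 N (dshift Dur) (dshift Dui) ->
    normk_finite sigma 2 N (dshift Dur) (dshift Dui) ->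
    normb_finite sigma N (dshift Dur) (dshift Dui) ->
    normk sigma 0 N (dshift Dur) (dshift Dui)
    + normk sigma 1 N (dshift Dur) (dshift Dui)
    + normk sigma 2 N (dshift Dur) (dshift Dui)
    + normb sigma N (dshift Dur) (dshift Dui)
    <= M * (normk sigma 0 N Dfr Dfi + normk sigma 1 N Dfr Dfi
            + normb sigma N Dfr Dfi).

Lemma estimate_at_mono (sigma M M' a b : R) :
  M <= M' -> estimate_at sigma M a b -> estimate_at sigma M' a b.
Proof.
  intros HM H N lambda kappa Dur Dui Dfr Dfi HN. intros.
  eapply Rle_trans; [apply (H N lambda kappa Dur Dui Dfr Dfi); assumption || lra|].
  apply Rmult_le_compat_r; [|exact HM].
  unfold normk, normb.
  repeat apply Rplus_le_le_0_compat; apply sqrt_pos.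
Qed.

Lemma admissible_estimate (sigma alpha beta rho L T0 T1 delta : R) (N0 : nat) :
  0 < sigma -> admissible sigma alpha beta rho L T0 T1 delta N0 ->
  exists M, 0 < M /\ forall a b,
    - alpha <= a -> beta <= Rabs b ->
    (forall k, 0 <= k -> rho ^ 2 <= (k + a) ^ 2 + b ^ 2) ->
    estimate_at sigma M a b.
Proof.
  intros Hs (Hr & HL & H01 & HT1 & Hd & HN0 & Hbr & HE).
  destruct (scaled_estimate sigma alpha beta rho L T0 T1 delta Hs Hr HL H01 HT1 Hd)
    as [K [HK HKe]].
  assert (His : 0 < / sigma) by (apply Rinv_0_lt_compat, Hs).
  assert (His2 : 0 < / sigma ^ 2) by (apply Rinv_0_lt_compat; nra).
  (* The first factor undoes the powers of sigma relating [energy], [energy2] and [trace0] of V to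
     the series terms, the factor [1 + / sigma] those for F. In [C] below, 4 counts the norms of u'
     and the 2 under the root comes from bounding the k = 1 series by two others. *)
  set (K' := (1 + / sigma ^ 2 + sigma) * (K * (1 + / sigma))).
  assert (HK' : 0 < K') by (repeat apply Rmult_lt_0_compat; lra).
  set (C := 4 * sqrt (2 * K')).
  assert (HC : 0 <= C) by (pose proof (sqrt_pos (2 * K')); unfold C; lra).
  pose proof (pos_INR N0) as HN0p.
  exists (INR N0 + C + 1). split; [lra|].
  intros a b Ha Hb Hab.
  intros N lambda kappa Dur Dui Dfr Dfi HN Hk Sr Si Sfr Sfi Er Ei
    Ff0 Ff1 Ffb Fu0 Fu1 Fu2 Fub.
  assert (HNN : (N0 <= N)%nat) by (apply INR_le; lra).
  assert (HN1 : (1 <= N)%nat) by lia.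
  pose proof (fun n => smooth_contI Dfr n Sfr) as CFr.
  pose proof (fun n => smooth_contI Dfi n Sfi) as CFi.
  assert (CVr : forall n, contI (dshift Dur n)) by (intros n; exact (smooth_contI Dur (S n) Sr)).
  assert (CVi : forall n, contI (dshift Dui n)) by (intros n; exact (smooth_contI Dui (S n) Si)).
  set (Vr := rescale sigma (dshift Dur)). set (Vi := rescale sigma (dshift Dui)).
  set (Fr := rescale sigma Dfr). set (Fi := rescale sigma Dfi).
  assert (Hs0 : sigma <> 0) by lra.
  assert (HS : scaled_system sigma kappa a b N Vr Vi Fr Fi).
  { constructor.
    - intros. apply rescale_deriv; assumption.
    - intros. apply rescale_deriv; assumption.
    - intros n. unfold Fr, rescale. contI_solve.
    - intros n. unfold Fi, rescale. contI_solve.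
    - intros. apply (rescale_ode sigma N lambda kappa a b Dur Dui Dfr); assumption.
    - intros n x Hn Hx.
      (* Exchanging real and imaginary parts turns the imaginary equation into the real one with
         [- b] for [b]. *)
      rewrite <- (rescale_ode sigma N lambda kappa a (- b) Dui Dur Dfi) with (x := x);
        try assumption.
      + unfold Vi, Vr. ring.
      + intros y Hy. rewrite <- (Ei y Hy). ring. }
  pose proof (series_value_spec _ _ Ff0) as Lf0.
  pose proof (series_value_spec _ _ Ff1) as Lf1.
  pose proof (series_value_spec _ _ Ffb) as Lfb.
  pose proof (series_value_spec _ _ Fu0) as Lu0.
  pose proof (series_value_spec _ _ Fu1) as Lu1.
  pose proof (series_value_spec _ _ Fu2) as Lu2.
  pose proof (series_value_spec _ _ Fub) as Lub.
  unfold normk, normb.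
  set (sf0 := series_value (term_k sigma 0 Dfr Dfi) N) in *.
  set (sf1 := series_value (term_k sigma 1 Dfr Dfi) N) in *.
  set (sfb := series_value (term_b sigma Dfr Dfi) N) in *.
  set (su0 := series_value (term_k sigma 0 (dshift Dur) (dshift Dui)) N) in *.
  set (su1 := series_value (term_k sigma 1 (dshift Dur) (dshift Dui)) N) in *.
  set (su2 := series_value (term_k sigma 2 (dshift Dur) (dshift Dui)) N) in *.
  set (sub := series_value (term_b sigma (dshift Dur) (dshift Dui)) N) in *.
  assert (HT : 1 * su0 + sigma ^ 2 * su2 + / sigma * sub <= K * (1 * sf0 + / sigma * sfb)).
  { apply (HKe N kappa a b Vr Vi Fr Fi); try assumption.
    - intros n T Hn. apply Hbr. lia.
    - intros n Hn. apply HE. lia.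
    - refine (Un_cv_series_scal 1 _ _ N _ _ Lu0). intros n.
      rewrite term_k_energy by assumption. symmetry. apply Rmult_1_l.
    - refine (Un_cv_series_scal (sigma ^ 2) _ _ N _ _ Lu2). intros n.
      rewrite term_k_energy2 by assumption. unfold Vr, Vi. field. exact Hs0.
    - refine (Un_cv_series_scal (/ sigma) _ _ N _ _ Lub). intros n.
      rewrite term_b_trace0. unfold Vr, Vi. field. exact Hs0.
    - refine (Un_cv_series_scal 1 _ _ N _ _ Lf0). intros n.
      rewrite term_k_energy by assumption. symmetry. apply Rmult_1_l.
    - refine (Un_cv_series_scal (/ sigma) _ _ N _ _ Lfb). intros n.
      rewrite term_b_trace0. unfold Fr, Fi. field. exact Hs0. }
  assert (Hlim0 : forall u l, (forall n, 0 <= u n) -> Un_cv (series_from u N) l -> 0 <= l).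
  { intros u l Hu Hl. apply Rle_trans with (series_from u N 0).
    - apply series_from_ge0, Hu.
    - apply Un_cv_series_ge; assumption. }
  assert (Htb : forall D E n, 0 <= term_b sigma D E n).
  { intros D E n. rewrite term_b_trace0. apply Rmult_le_pos; [lra|apply trace0_ge0]. }
  assert (Pf0 : 0 <= sf0)
    by (apply (Hlim0 _ _ (fun n => term_k_ge0 sigma 0 Dfr Dfi n Hs CFr CFi) Lf0)).
  assert (Pf1 : 0 <= sf1)
    by (apply (Hlim0 _ _ (fun n => term_k_ge0 sigma 1 Dfr Dfi n Hs CFr CFi) Lf1)).
  assert (Pfb : 0 <= sfb) by (apply (Hlim0 _ _ (Htb _ _) Lfb)).
  assert (Pu0 : 0 <= su0)
    by (apply (Hlim0 _ _ (fun n => term_k_ge0 sigma 0 _ _ n Hs CVr CVi) Lu0)).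
  assert (Pu2 : 0 <= su2)
    by (apply (Hlim0 _ _ (fun n => term_k_ge0 sigma 2 _ _ n Hs CVr CVi) Lu2)).
  assert (Pub : 0 <= sub) by (apply (Hlim0 _ _ (Htb _ _) Lub)).
  assert (H1 : su1 <= su0 + su2).
  { apply (Un_cv_le _ _ _ Lu1). intros m.
    eapply Rle_trans.
    - apply series_from_le. intros n _. apply (term_k_interpolate sigma _ _ n Hs CVr CVi).
    - rewrite series_from_plus. apply Rplus_le_compat; apply Un_cv_series_ge; auto;
        intros n; apply term_k_ge0; assumption. }
  assert (HT' : K * (1 * sf0 + / sigma * sfb) <= K * (1 + / sigma) * (sf0 + sfb)).
  { rewrite Rmult_assoc. apply Rmult_le_compat_l; [lra|].
    assert (0 <= / sigma * sf0) by (apply Rmult_le_pos; lra). lra. }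
  set (Q := K * (1 + / sigma) * (sf0 + sfb)) in *.
  assert (P2 : 0 <= sigma ^ 2 * su2) by (apply Rmult_le_pos; [nra|lra]).
  assert (Pb : 0 <= / sigma * sub) by (apply Rmult_le_pos; lra).
  assert (HQ0 : 0 <= Q) by lra.
  assert (HKQ : K' * (sf0 + sfb) = Q + / sigma ^ 2 * Q + sigma * Q) by (unfold K', Q; ring).
  assert (Q2 : 0 <= / sigma ^ 2 * Q) by (apply Rmult_le_pos; lra).
  assert (Q3 : 0 <= sigma * Q) by (apply Rmult_le_pos; lra).
  assert (B0 : su0 <= K' * (sf0 + sfb)) by lra.
  assert (B2 : su2 <= K' * (sf0 + sfb)).
  { assert (/ sigma ^ 2 * (sigma ^ 2 * su2) <= / sigma ^ 2 * Q)
      by (apply Rmult_le_compat_l; lra).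
    replace (/ sigma ^ 2 * (sigma ^ 2 * su2)) with su2 in H by (field; exact Hs0). lra. }
  assert (Bb : sub <= K' * (sf0 + sfb)).
  { assert (sigma * (/ sigma * sub) <= sigma * Q) by (apply Rmult_le_compat_l; lra).
    replace (sigma * (/ sigma * sub)) with sub in H by (field; exact Hs0). lra. }
  assert (HB : forall t, t <= 2 * K' * (sf0 + sfb) ->
    sqrt t <= sqrt (2 * K') * (sqrt sf0 + sqrt sf1 + sqrt sfb))
    by (intros; apply sqrt_sum_bound; lra).
  pose proof (HB su0 ltac:(lra)). pose proof (HB su1 ltac:(lra)).
  pose proof (HB su2 ltac:(lra)). pose proof (HB sub ltac:(lra)).
  pose proof (sqrt_pos sf0). pose proof (sqrt_pos sf1). pose proof (sqrt_pos sfb).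
  apply Rle_trans with (C * (sqrt sf0 + sqrt sf1 + sqrt sfb)); [unfold C; lra|].
  apply Rmult_le_compat_r; lra.
Qed.

Lemma estimate_near (sigma a0 b0 : R) : 0 < sigma -> Omega sigma a0 b0 ->
  exists M, 0 < M /\ forall a b,
    Rabs (a - a0) < / M -> Rabs (b - b0) < / M -> estimate_at sigma M a b.
Proof.
  intros Hs HO.
  assert (exists alpha beta rho L T0 T1 delta N d,
    admissible sigma alpha beta rho L T0 T1 delta N /\ 0 < d /\
    forall a b, Rabs (a - a0) < d -> Rabs (b - b0) < d ->
      - alpha <= a /\ beta <= Rabs b /\
      forall k, 0 <= k -> rho ^ 2 <= (k + a) ^ 2 + b ^ 2)
    as (alpha & beta & rho & L & T0 & T1 & delta & N & d & Had & Hd & Hnear).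
  { destruct (Omega_dichotomy sigma a0 b0 Hs HO) as [[H1 H2]|(H1 & H2 & H3)].
    - apply admissible_right; assumption.
    - apply admissible_left; assumption. }
  destruct (admissible_estimate _ _ _ _ _ _ _ _ _ Hs Had) as [M [HM Hest]].
  assert (Hid : 0 < / d) by (apply Rinv_0_lt_compat, Hd).
  assert (Hle : / (M + / d) <= d).
  { rewrite <- (Rinv_inv d) at 2. apply Rinv_le_contravar; lra. }
  exists (M + / d). split; [lra|]. intros a b Hda Hdb.
  apply estimate_at_mono with M; [lra|].
  destruct (Hnear a b) as (H1 & H2 & H3); try lra. apply Hest; assumption.
Qed.

(** * Uniformity by compactness *)

Lemma dist2_lt (a b a' b' d : R) :
  Rabs (a' - a) < d / 2 -> Rabs (b' - b) < d / 2 -> dist2 a b a' b' < d.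
Proof.
  intros Ha Hb. apply Rabs_def2 in Ha, Hb. unfold dist2.
  apply Rsqr_incrst_0; [|apply cabs_ge0|lra].
  rewrite !Rsqr_pow2, cabs_sqr. nra.
Qed.

Lemma closure2_incl (U : R -> R -> Prop) (a b : R) : U a b -> closure2 U a b.
Proof.
  intros H eps Heps. exists a, b. split; [exact H|].
  apply dist2_lt; rewrite Rminus_diag, Rabs_R0; lra.
Qed.

(* Radius and constant are tied together as [/ M] and [M], so that the positive
   lower bound on the radii given by compactness also bounds the constants. *)
Lemma estimate_uniform (sigma : R) (U : R -> R -> Prop) :
  0 < sigma -> compact_closure_in U (Omega sigma) ->
  exists M, 0 < M /\ forall a b, U a b -> estimate_at sigma M a b.
Proof.
  intros Hs [[B HB] HU].
  assert (Hloc : forall a0 b0, exists d : posreal, forall a b, U a b ->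
    Rabs (a - a0) < d -> Rabs (b - b0) < d -> estimate_at sigma (/ d) a b).
  { intros a0 b0. destruct (classic (closure2 U a0 b0)) as [Hc|Hc].
    - destruct (estimate_near sigma a0 b0 Hs (HU _ _ Hc)) as [M [HM H]].
      exists (mkposreal _ (Rinv_0_lt_compat _ HM)). simpl. rewrite Rinv_inv.
      intros a b _. apply H.
    - apply not_all_ex_not in Hc. destruct Hc as [e He].
      apply imply_to_and in He. destruct He as [He Hn].
      assert (He2 : 0 < e / 2) by lra.
      exists (mkposreal _ He2). simpl. intros a b Hab Ha Hb. exfalso. apply Hn.
      exists a, b. split; [exact Hab|]. apply dist2_lt; assumption. }
  set (delta := fun a0 b0 =>
    proj1_sig (constructive_indefinite_description _ (Hloc a0 b0))).
  assert (Hdelta : forall a0 b0 a b, U a b ->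
    Rabs (a - a0) < delta a0 b0 -> Rabs (b - b0) < delta a0 b0 ->
    estimate_at sigma (/ delta a0 b0) a b).
  { intros a0 b0. apply (proj2_sig (constructive_indefinite_description _ (Hloc a0 b0))). }
  destruct (compactness_value_2d (- B) B (- B) B delta) as [d Hd].
  exists (/ d). split; [apply Rinv_0_lt_compat, cond_pos|].
  intros a b Hab.
  pose proof (HB a b (closure2_incl U a b Hab)) as Hcb.
  pose proof (cabs_ge_snd a b) as Hb.
  assert (Ha : Rabs a <= cabs a b).
  { replace (cabs a b) with (cabs b a) by (unfold cabs; f_equal; ring).
    apply cabs_ge_snd. }
  assert (Ha' : - B <= a <= B) by (apply Rabs_le_between; lra).
  assert (Hb' : - B <= b <= B) by (apply Rabs_le_between; lra).
  (* The compactness theorem provides the centre [(u, v)] only under a double negation, which is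
     removed since the goal is a proposition. *)
  apply NNPP. intros Hn. apply (Hd a b Ha' Hb'). intros (u & v & _ & _ & Hu & Hv & Hdu).
  apply Hn. apply estimate_at_mono with (/ delta u v).
  - apply Rinv_le_contravar; [apply cond_pos|exact Hdu].
  - apply Hdelta; assumption.
Qed.

Theorem mainTheorem11 (sigma : R) (Upsilon : R -> R -> Prop) :
  0 < sigma ->
  open2 Upsilon ->
  compact_closure_in Upsilon (Omega sigma) ->
  exists (N0 : nat) (C : R), 0 < C /\
  forall (N : nat) (lambda kappa a b : R)
         (Dur Dui Dfr Dfi : nat -> R -> R),
    (N0 <= N)%nat -> 0 <= kappa -> Upsilon a b ->
    smooth_seq Dur -> smooth_seq Dui -> smooth_seq Dfr -> smooth_seq Dfi ->
    (* the equation, real and imaginary parts, with s = a + i b,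
       u = Dur 0 + i Dui 0, f = Dfr 0 + i Dfi 0, and
       d/dx((kappa x + x^2) u') = (kappa + 2x) u' + (kappa x + x^2) u'' *)
    (forall x, inI x ->
       (kappa + 2 * x) * Dur 1%nat x + (kappa * x + x ^ 2) * Dur 2%nat x
       + (a * Dur 1%nat x - b * Dui 1%nat x)
       - INR N * (INR N + 1) * Dur 0%nat x
       + lambda * sumR N (fun i => (x - 1) ^ i / INR (fact i) * Dur (S i) 1)
       = Dfr 0%nat x) ->
    (forall x, inI x ->
       (kappa + 2 * x) * Dui 1%nat x + (kappa * x + x ^ 2) * Dui 2%nat x
       + (a * Dui 1%nat x + b * Dur 1%nat x)
       - INR N * (INR N + 1) * Dui 0%nat x
       + lambda * sumR N (fun i => (x - 1) ^ i / INR (fact i) * Dui (S i) 1)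
       = Dfi 0%nat x) ->
    Dur 0%nat 1 = 0 -> Dui 0%nat 1 = 0 ->
    normk_finite sigma 0 N Dfr Dfi -> normk_finite sigma 1 N Dfr Dfi ->
    normb_finite sigma N Dfr Dfi ->
    normk_finite sigma 0 N (dshift Dur) (dshift Dui) ->
    normk_finite sigma 1 N (dshift Dur) (dshift Dui) ->
    normk_finite sigma 2 N (dshift Dur) (dshift Dui) ->
    normb_finite sigma N (dshift Dur) (dshift Dui) ->
    normk sigma 0 N (dshift Dur) (dshift Dui)
    + normk sigma 1 N (dshift Dur) (dshift Dui)
    + normk sigma 2 N (dshift Dur) (dshift Dui)
    + normb sigma N (dshift Dur) (dshift Dui)
    <= C * (normk sigma 0 N Dfr Dfi + normk sigma 1 N Dfr Dfi
            + normb sigma N Dfr Dfi).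
Proof.
  intros Hs _ Hc.
  destruct (estimate_uniform sigma Upsilon Hs Hc) as [M [HM H]].
  destruct (INR_unbounded M) as [N0 HN0].
  exists N0, M. split; [exact HM|].
  intros N lambda kappa a b Dur Dui Dfr Dfi HN Hk Hab Hr Hi Hfr Hfi Er Ei _ _.
  apply le_INR in HN.
  apply (H a b Hab N lambda kappa); try assumption. lra.
Qed.
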